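(* For any initial distribution $m^0 \in \mathcal{P}_N$, there exists a $C^1$ solution $(u,m)$ on $[0,T]$ of the $\mathcal{G}$-MFG equations with initial distribution $m^0$.
   Context: Let $T>0$ and let $\mathcal{G}$ be a directed graph with node set $\mathcal{N} = \{1,\ldots,N\}$. For $i \in \mathcal{N}$, $\mathcal{V}(i) \subset \mathcal{N}\setminus\{i\}$ is the set of nodes $j$ such that there is a directed edge from $i$ to $j$, $d_i$ is the cardinality of $\mathcal{V}(i)$, and $\mathcal{V}^{-1}(i) \subset \mathcal{N}\setminus\{i\}$ is the set of nodes $j$ such that there is a directed edge from $j$ to $i$. Vectors $p \in \mathbb{R}^{d_i}$ are indexed by $\mathcal{V}(i)$: $p = (p_j)_{j\in\mathcal{V}(i)}$. Set $\mathbb{R}_+ = [0,\infty)$ and $\mathcal{P}_N = \{(\mu_1,\ldots,\mu_N) \in \mathbb{R}_+^N : \sum_{i=1}^N \mu_i = 1\}$. For each $i \in \mathcal{N}$ there are given functions $\mathcal{L}(i,\cdot,\cdot) : \mathbb{R}_+^{d_i}\times\mathbb{R}_+^N \to \mathbb{R}_+$ (cost), $f(i,\cdot) : \mathbb{R}_+^N \to \mathbb{R}$ (instantaneous payoff) and $g(i,\cdot) : \mathbb{R}_+^N \to \mathbb{R}$ (terminal payoff), with the following standing assumptions for every $i\in\mathcal{N}$: - $\mathcal{L}(i,\cdot,\cdot)$, $f(i,\cdot)$ and $g(i,\cdot)$ are continuous; - for every $\mu \in \mathbb{R}_+^N$, $\mathcal{L}(i,\cdot,\mu)$ is strictly convex;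 - for every $K>0$, $\displaystyle\lim_{\lambda \in \mathbb{R}_+^{d_i},\,|\lambda|\to+\infty}\ \inf_{\mu \in [0,K]^N} \frac{\mathcal{L}(i,\lambda,\mu)}{|\lambda|} = +\infty$. The Hamiltonian functions are defined, for $i\in\mathcal{N}$ and $(p,\mu) \in \mathbb{R}^{d_i}\times\mathbb{R}_+^N$, by $$\mathcal{H}(i,p,\mu) = \sup_{\lambda \in \mathbb{R}_+^{d_i}} \lambda\cdot p - \mathcal{L}(i,\lambda,\mu).$$ It is a known fact that $\mathcal{H}(i,\cdot,\cdot)$ is continuous, that $\mathcal{H}(i,\cdot,\mu)$ is $C^1$ for every $\mu\in\mathbb{R}_+^N$, and that $\nabla_p\mathcal{H}(i,\cdot,\cdot)$ is continuous with $\nabla_p \mathcal{H}(i,p,\mu) = \mathrm{argmax}_{\lambda \in \mathbb{R}_+^{d_i}}\, \lambda\cdot p - \mathcal{L}(i,\lambda,\mu)$. For $j \in \mathcal{V}(i)$, $\frac{\partial\mathcal{H}}{\partial p_j}(i,p,\mu)$ denotes the partial derivative with respect to the component of $p$ indexed by $j$. The $\mathcal{G}$-MFG equations with initial distribution $m^0\in\mathcal{P}_N$ are the following system of $2N$ equations, whose unknown is $t \in [0,T] \mapsto (u(t),m(t)) = (u(1,t),\ldots,u(N,t),m(1,t),\ldots,m(N,t))$, where $u(t)\in\mathbb{R}^N$ and $m(t) \in \mathcal{P}_N$: (Hamilton-Jacobi equations) for all $i\in\mathcal{N}$ and $t\in[0,T]$, $$\frac{d}{dt} u(i,t) + \mathcal{H}\left(i,(u(j,t)-u(i,t))_{j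 \in \mathcal{V}(i)},m(t)\right) + f(i,m(t))=0, \qquad u(i,T) = g(i,m(T));$$ (forward transport equations) for all $i\in\mathcal{N}$ and $t\in[0,T]$, $$\frac{d}{dt} m(i,t) = \sum_{j \in \mathcal{V}^{-1}(i)} \frac{\partial \mathcal{H}}{\partial p_i}\left(j,(u(k,t)-u(j,t))_{k \in \mathcal{V}(j)},m(t)\right) m(j,t) - \sum_{j \in \mathcal{V}(i)} \frac{\partial \mathcal{H}}{\partial p_j}\left(i,(u(k,t)-u(i,t))_{k \in \mathcal{V}(i)},m(t)\right) m(i,t),$$ with $(m(1,0),\ldots,m(N,0)) = m^0$. *)

(* Defs.v *)
From HB Require Import structures.
From mathcomp Require Import all_boot all_order all_algebra.
From mathcomp Require Import all_classical all_reals all_analysis.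

Set Implicit Arguments.
Unset Strict Implicit.
Unset Printing Implicit Defensive.

Import Order.TTheory GRing.Theory Num.Theory.
Import numFieldNormedType.Exports.

Local Open Scope classical_set_scope.
Local Open Scope ring_scope.

Section Euclidean.
Variable R : realType.

Definition dot (n : nat) (x y : 'rV[R]_n) : R := \sum_(k < n) x 0 k * y 0 k.

(* The library norm on ['rV[R]_n] is the sup norm. *)
Definition enorm (n : nat) (x : 'rV[R]_n) : R := Num.sqrt (dot x x).

Definition orthant (n : nat) : set 'rV[R]_n :=
  [set x | forall k, 0 <= x 0 k].

Definition cube (n : nat) (K : R) : set 'rV[R]_n :=
  [set x | forall k, 0 <= x 0 k <= K].

Definition simplex (n : nat) : set 'rV[R]_n :=
  [set x | orthant x /\ \sum_(k < n) x 0 k = 1].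

Definition strictly_convex_on (E : lmodType R) (A : set E) (F : E -> R) :=
  forall (x y : E) (s : R), A x -> A y -> x != y -> 0 < s < 1 ->
    F (s *: x + (1 - s) *: y) < s * F x + (1 - s) * F y.

End Euclidean.

(* Derivatives relative to a set: one-sided at the endpoints of an interval. *)
Section RelativeDerivative.
Variables (R : realType) (A : set R) (F : R -> R).

Definition diff_quotient (t : R) : R -> R := fun s => (F s - F t) / (s - t).

Definition derivable_on (t : R) : Prop :=
  cvg (diff_quotient t @ within A t^').

Definition derive_on (t : R) : R := lim (diff_quotient t @ within A t^').

Definition C1_on : Prop :=
  (forall t, A t -> derivable_on t) /\ {within A, continuous derive_on}.

End RelativeDerivative.

(* [e i j] means that there is a directed edge from i to j; the nodes are
   numbered from 0. *)
Section Graph.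
Variables (N : nat) (e : rel 'I_N).

Definition succs (i : 'I_N) : {set 'I_N} := [set j | e i j]%SET.
Definition preds (i : 'I_N) : {set 'I_N} := [set j | e j i]%SET.
Definition deg (i : 'I_N) : nat := #|succs i|.

End Graph.

(* A vector indexed by the successors of i is a row vector of size [deg e i]
   whose k-th entry belongs to the successor [enum_val k]. *)
Section MFG.
Variables (R : realType) (N : nat) (e : rel 'I_N).

Definition succ_of (i : 'I_N) (k : 'I_(deg e i)) : 'I_N := enum_val k.

Definition basis_vec (i j : 'I_N) : 'rV[R]_(deg e i) :=
  \row_(k < deg e i) (succ_of k == j)%:R.

Definition increments (i : 'I_N) (v : 'rV[R]_N) : 'rV[R]_(deg e i) :=
  \row_(k < deg e i) (v 0 (succ_of k) - v 0 i).

(* The cost is a total function; only its values on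
   [orthant `*` orthant] are ever used or constrained. *)
Variable L : forall i : 'I_N, 'rV[R]_(deg e i) -> 'rV[R]_N -> R.

(* lim_(|l| -> +oo, l in the orthant) inf_(mu in [0, K]^N) L(i, l, mu) / |l|
   = +oo; the infima are over nonempty sets, bounded below since L >= 0. *)
Definition superlinear (i : 'I_N) (K : R) : Prop :=
  forall B : R, exists r : R, forall l : 'rV[R]_(deg e i),
    orthant l -> r < enorm l ->
    B < inf [set L l mu / enorm l | mu in @cube R N K].

(* The supremum is finite for mu in the orthant, by superlinearity. *)
Definition Ham (i : 'I_N) (p : 'rV[R]_(deg e i)) (mu : 'rV[R]_N) : R :=
  sup [set dot l p - L l mu | l in @orthant R (deg e i)].

(* Partial derivative with respect to the component of p indexed by the
   successor j of i. *)
Definition dHam (i j : 'I_N) (p : 'rV[R]_(deg e i)) (mu : 'rV[R]_N) : R :=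
  'D_(basis_vec i j) (fun q => Ham q mu) p.

Variables (f g : 'I_N -> 'rV[R]_N -> R) (T : R).
Variables (m0 : 'rV[R]_N) (u m : R -> 'rV[R]_N).

Definition hamilton_jacobi : Prop := forall i : 'I_N,
  (forall t, t \in `[0, T] ->
    derive_on [set` `[0, T]] (fun s => u s 0 i) t
      + Ham (increments i (u t)) (m t) + f i (m t) = 0)
  /\ u T 0 i = g i (m T).

Definition forward_transport : Prop :=
  (forall (i : 'I_N) (t : R), t \in `[0, T] ->
    derive_on [set` `[0, T]] (fun s => m s 0 i) t =
      \sum_(j in preds e i) dHam i (increments j (u t)) (m t) * m t 0 j
      - \sum_(j in succs e i) dHam j (increments i (u t)) (m t) * m t 0 i)
  /\ m 0 = m0.

Definition C1_mfg_solution : Prop :=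
  [/\ forall t, t \in `[0, T] -> simplex (m t),
      forall i : 'I_N, C1_on [set` `[0, T]] (fun s => u s 0 i),
      forall i : 'I_N, C1_on [set` `[0, T]] (fun s => m s 0 i),
      hamilton_jacobi
    & forward_transport].

End MFG.

(* Main.v *)
Require Import Defs.
From HB Require Import structures.
From mathcomp Require Import all_boot all_order all_algebra.
From mathcomp Require Import zify ring lra.

Set Implicit Arguments.
Unset Strict Implicit.
Unset Printing Implicit Defensive.

(** Write lambda(p, mu) for the maximiser of lambda . p - L(lambda, mu), which
    is unique by strict convexity and exists by superlinearity. The system
    reads u' = - b(u, m) and m' = drift(u, m): the Hamilton-Jacobi equations
    run backward from u(T) = g(m(T)), and the transport equations are the
    Kolmogorov equations of the jump process of rates lambda. Time is
    discretised with step h = T / K, where everything becomes finite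
    dimensional, and then K goes to infinity.

    Discrete equilibrium. Any sequence m_0, ..., m_K of distributions
    determines u_K, ..., u_0 by the backward Euler recursion, and then a new
    sequence of distributions by the forward Euler recursion driven by the
    rates lambda. Since lambda = 0 is a competitor in the Hamiltonian, since
    L >= 0, and since a step with total jump probability at most 1 averages
    the values of u, the recursion increases max |u| by at most h F, where F is
    a constant ([legendre_step_le], [legendre_ge]). For small h this bounds
    u by G + T F, hence bounds the rates, hence makes each forward step a
    stochastic matrix. So the response map preserves a product of simplices;
    it is continuous, and Brouwer's theorem ([brouwer_simplices]) yields a
    sequence which is its own response ([discrete_equilibrium]).

    Brouwer's theorem is derived from a combinatorial lemma of Scarf
    ([scarf]): points of a finite set, ordered once for each coordinate and
    completed by slack points, admit a fully labelled dominant set. On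
    a fine grid of the simplex a dominant set is small ([sperner_grid]), and
    labelling a grid point x by a coordinate i with F(x)_i >= x_i produces
    approximate fixed points.

    Passage to the limit. All the step functions obtained are bounded, so they
    converge pointwise along a fixed ultrafilter on the integers. They are also
    uniformly Lipschitz up to an error O(h). Hence on a short interval around t
    all the states of the scheme are close to the limit state Z(t), and the
    increment of the scheme over [t, s] is (s - t) W(Z(t)) up to a small
    multiple of |s - t| ([limit_increment]); this is differentiability of the
    limit, with the desired derivative.

    The Hamiltonian itself is handled through lambda: the affine minorants
    given by the maximisers squeeze the difference quotients of H between
    lambda(p) . v and lambda(p + h v) . v, and lambda is continuous
    ([argmax_continuous]), so the directional derivatives of H are
    lambda . v ([derive_legendre]). *)

(** * A parity lemma on dominant sets *)

(** The points of [P] carry one linear order per colour [i], that of [ht i].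
    The slack points [s i] stand for the facets of the simplex: [s i] is lowest
    for its own colour and lies above all ordinary points for the others.
    Dominant sets of size [#|I|] and [#|I| - 1] are called rooms and doors
    below; the doors of a room are obtained by removal of one point. *)
Section Scarf.
Variables (P I : finType) (ht : I -> P -> nat) (s : I -> P) (c : P -> I).
Hypothesis ht_inj : forall i, injective (ht i).
Hypothesis s_min : forall i x, ht i (s i) <= ht i x.
Hypothesis s_top : forall i j x, j != i -> x \notin codom s -> ht i x < ht i (s j).
Hypothesis sK : cancel s c.

Definition dominant (X : {set P}) :=
  [forall y, exists i, forall x in X, ht i y <= ht i x].

Lemma dominantP (X : {set P}) :
  reflect (forall y, exists i, forall x, x \in X -> ht i y <= ht i x) (dominant X).
Proof.
apply: (iffP forallP) => H y; have := H y.
  by move=> /existsP[i /forall_inP h]; exists i.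
by move=> [i h]; apply/existsP; exists i; apply/forall_inP.
Qed.

Lemma dominantS (X Y : {set P}) : X \subset Y -> dominant Y -> dominant X.
Proof.
move=> /subsetP XY /dominantP dY; apply/dominantP => y.
by have [i h] := dY y; exists i => x /XY /h.
Qed.

(** Walking through doors that carry all colours but [i0]: a room that misses
    a colour has no such door, or has exactly two of them, namely those obtained
    by removing one of the two points that share a colour. *)
Lemma room_even (i0 : I) (X : {set P}) :
  #|X| = #|I| -> c @: X != [set: I] ->
  ~~ odd #|[set x in X | c @: (X :\ x) == [set~ i0]]|.
Proof.
move=> cardX ncol; set A := [set x in X | _].
have injA y : y \in A -> {in X :\ y &, injective c}.
  rewrite inE => /andP[yX /eqP cy]; apply/imset_injP; rewrite cy cardsC1.
  by rewrite -cardX (cardsD1 y X) yX.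
have [->|[x xA]] := set_0Vmem A; first by rewrite cards0.
have := xA; rewrite inE => /andP[xX /eqP cx].
have cxi0 : c x != i0.
  apply: contra ncol => /eqP e; rewrite -(setD1K xX) imsetU1 cx e.
  by rewrite setUCr.
have /imsetP[x' x'X cxx'] : c x \in c @: (X :\ x) by rewrite cx !inE.
have := x'X; rewrite !inE => /andP[x'x x'X1].
suff -> : A = [set x; x'] by rewrite cards2 eq_sym x'x.
apply/setP => y; rewrite !inE; apply/andP/orP => [[yX cy]|].
  have [_|nyx] := eqVneq y x; first by left.
  have [_|nyx'] := eqVneq y x'; first by right.
  have yA : y \in A by rewrite inE yX.
  have /(_ _ _ cxx') e := injA y yA x x'.
  by move: x'x; rewrite -e ?eqxx // !inE ?xX ?x'X1 eq_sym ?nyx ?nyx'.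
case=> /eqP->; first by rewrite xX cx.
split=> //; rewrite eqEsubset; apply/andP; split; apply/subsetP => i.
  move=> /imsetP[z]; rewrite !inE => /andP[zx' zX] ->.
  have [->//|zx] := eqVneq z x.
  have : c z \in [set~ i0] by rewrite -cx imset_f // !inE zx zX.
  by rewrite !inE.
rewrite -cx => /imsetP[z]; rewrite !inE => /andP[zx zX] ->.
have [->|zx'] := eqVneq z x'; last by rewrite imset_f // !inE zx' zX.
by rewrite -cxx' imset_f // !inE eq_sym x'x xX.
Qed.

(** The only door made of slack points that carries all colours but [i0] leads
    to a single room, the one that contains the highest ordinary point for
    [i0]. *)
Lemma outer_door_odd (i0 : I) : (exists x, x \notin codom s) ->
  odd #|[set x | (x \notin s @: [set~ i0]) && dominant (x |: s @: [set~ i0])]|.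
Proof.
move=> [x0 x0s]; set Y := s @: _.
pose b := [arg max_(x > x0 | x \notin codom s) ht i0 x].
have [bs bmax] : b \notin codom s /\ forall x, x \notin codom s -> ht i0 x <= ht i0 b.
  by rewrite /b; case: arg_maxnP.
have inY i : i != i0 -> s i \in Y by move=> h; rewrite imset_f // !inE.
have nY x : x \notin codom s -> x \notin Y.
  by apply: contra => /imsetP[i _ ->]; rewrite codom_f.
suff -> : [set x | (x \notin Y) && dominant (x |: Y)] = [set b] by rewrite cards1.
apply/setP => x; rewrite !inE; apply/andP/eqP => [[xY /dominantP dx]|->].
  have key y : y \notin codom s -> ht i0 y <= ht i0 x.
    move=> ys; have [i h] := dx y.
    have [<-|ni] := eqVneq i i0; first by apply: h; rewrite !inE eqxx.
    have := h (s i); rewrite !inE inY // orbT => /(_ isT).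
    by rewrite leqNgt ltn_neqAle s_min (inj_eq (@ht_inj i)) andbT;
      case: eqP ys => // <-; rewrite codom_f.
  have xs : x \notin codom s.
    apply/negP => /codomP[i xi]; have [ii|/inY] := eqVneq i i0.
      have := key _ x0s; rewrite xi ii leqNgt ltn_neqAle s_min.
      by rewrite (inj_eq (@ht_inj _)) andbT; case: eqP x0s => // <-; rewrite codom_f.
    by rewrite -xi (negbTE xY).
  by apply: (@ht_inj i0); apply/eqP; rewrite eqn_leq key // bmax.
split; first exact: nY.
apply/dominantP => y.
have [/codomP[i ->]|ys] := boolP (y \in codom s); first by exists i => x' _.
exists i0 => x'; rewrite !inE => /orP[/eqP->|/imsetP[i]]; first exact: bmax.
by rewrite !inE => ni ->; rewrite ltnW // s_top.
Qed.

(** Each point of a dominant door [Y] is the lowest one of [Y] for some colour,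
    and there is one more colour than points, so exactly two colours [j] and [k]
    share their lowest point. A room containing [Y] arises by freeing one of
    them: among the points above the minima of all colours but [j], take the
    highest for [j]; likewise for [k]. *)
Lemma door_even (Y : {set P}) : #|Y|.+1 = #|I| ->
  ~~ (Y \subset codom s) ->
  ~~ odd #|[set x | (x \notin Y) && dominant (x |: Y)]|.
Proof.
move=> cardY /subsetPn[xs xsY xss].
have [/dominantP dY|ndY] := boolP (dominant Y); last first.
  rewrite (_ : [set x | _] = set0) ?cards0 //.
  apply/setP => x; rewrite !inE; apply/negbTE.
  apply: contra ndY => /andP[_]; apply: dominantS; exact: subsetUr.
pose m i := [arg min_(x < xs in Y) ht i x].
have mY i : m i \in Y by rewrite /m; case: arg_minnP.
have mmin i x : x \in Y -> ht i (m i) <= ht i x by rewrite /m; case: arg_minnP => // z _; exact.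
have mE i x : x \in Y -> (forall x', x' \in Y -> ht i x <= ht i x') -> x = m i.
  by move=> xY h; apply: (@ht_inj i); apply/eqP; rewrite eqn_leq h ?mmin.
have surj x : x \in Y -> exists i, x = m i.
  by move=> xY; have [i h] := dY x; exists i; apply: mE.
(* [m i] is the lowest point of [Y] for the colour [i]. *)
have imY : m @: [set: I] = Y.
  apply/setP => x; apply/imsetP/idP => [[i _ ->]|/surj[i ->]] //; by exists i.
have [j [k [njk mjk]]] : exists j k, j != k /\ m j = m k.
  have : ~~ [forall j, forall k, (m j == m k) ==> (j == k)].
    apply/negP => /forallP H.
    suff : #|m @: [set: I]| = #|[set: I]|.
      by rewrite imY cardsT -cardY => /n_Sn.
    apply: card_imset => j k /eqP e; apply/eqP.
    by move: (H j) => /forallP/(_ k); rewrite e.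
  rewrite negb_forall => /existsP[j]; rewrite negb_forall => /existsP[k].
  by rewrite negb_imply => /andP[/eqP e n]; exists j, k.
have minj a b : a != b -> m a = m b -> {in [set~ a] &, injective m}.
  move=> ab mab; apply/imset_injP; rewrite cardsC1 -cardY /= -imY.
  apply/eqP/eq_card => x; apply/imsetP/imsetP => -[i].
    by move=> _ ->; exists i.
  move=> _ ->; have [->|ia] := eqVneq i a; last by exists i; rewrite ?inE.
  by exists b; rewrite ?inE // eq_sym.
have injj := minj _ _ njk mjk.
have injk : {in [set~ k] &, injective m} by apply: (minj k j); rewrite // eq_sym.
have msl i l : l != i -> m i != s l.
  move=> li; apply: contraTneq (mmin i xs xsY) => ->.
  by rewrite -ltnNge s_top.
pose M a := [set y | [forall i, (i != a) ==> (ht i (m i) < ht i y)]].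
have MP a y : reflect (forall i, i != a -> ht i (m i) < ht i y) (y \in M a).
  rewrite inE; apply: (iffP forallP) => H i; last by apply/implyP; apply: H.
  by have /implyP := H i.
have sM a : s a \in M a.
  apply/MP => i ia; have [/codomP[l e]|h] := boolP (m i \in codom s); last first.
    by apply: s_top => //; rewrite eq_sym.
  have [li|/msl] := eqVneq l i; last by rewrite e eqxx.
  rewrite ltn_neqAle e li s_min andbT (inj_eq (@ht_inj _)) (inj_eq (can_inj sK)) //.
pose best a := [arg max_(x > s a in M a) ht a x].
have [bM bmax] : (forall a, best a \in M a) /\ forall a x, x \in M a -> ht a x <= ht a (best a).
  by split => a; rewrite /best; case: arg_maxnP.
have noM y : ~ (forall i, ht i (m i) < ht i y).
  by move=> h; have [i /(_ _ (mY i))] := dY y; rewrite leqNgt h.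
have bdom a b : a != b -> m a = m b -> best a \notin Y /\ dominant (best a |: Y).
  move=> ab mab; split.
    apply/negP => /surj[i e]; have /MP h := bM a.
    have [ia|ia] := eqVneq i a; last by have := h i ia; rewrite e ltnn.
    by have := h b; rewrite eq_sym ab e ia mab ltnn => /(_ isT).
  apply/forallP => y; apply: contraT => /existsPn H.
  have {}H i : exists2 x', x' \in best a |: Y & ht i x' < ht i y.
    have /forallPn[x'] := H i; rewrite negb_imply -ltnNge => /andP[]; by exists x'.
  have yM : y \in M a.
    apply/MP => i ia; have [x' + lt] := H i; rewrite !inE => /orP[/eqP e|x'Y].
      by apply: leq_trans lt; rewrite ltnS e ltnW //; exact: (MP _ _ (bM a)).
    exact: leq_ltn_trans (mmin _ _ x'Y) lt.
  have [x' + lt] := H a; rewrite !inE => /orP[/eqP e|x'Y].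
    by have := bmax _ _ yM; rewrite -e leqNgt lt.
  case: (noM y) => i; have [->|ia] := eqVneq i a; last exact: (MP _ _ yM).
  exact: leq_ltn_trans (mmin _ _ x'Y) lt.
have bestjk : best j != best k.
  apply/eqP => e; apply: (noM (best j)) => i.
  have [->|ij] := eqVneq i j; last exact: (MP _ _ (bM j)).
  by rewrite e; apply: (MP _ _ (bM k)).
suff -> : [set x | (x \notin Y) && dominant (x |: Y)] = [set best j; best k].
  by rewrite cards2 bestjk.
apply/setP => x; rewrite !inE; apply/andP/idP; last first.
  by case/orP => /eqP->; [apply: (bdom _ k)|apply: (bdom _ j)]; rewrite // eq_sym.
move=> [xY /dominantP dx].
have [l hl] := dx x.
have {hl}ltl : ht l x < ht l (m l).
  rewrite ltn_neqAle hl ?inE ?mY ?orbT // andbT (inj_eq (@ht_inj _)).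
  by apply: contraNneq xY => ->.
have dm i : exists2 i', m i' = m i & ht i' (m i) <= ht i' x.
  have [i' h] := dx (m i); exists i'; last by apply: h; rewrite !inE eqxx.
  by apply/esym/mE => // x' x'Y; apply: h; rewrite !inE x'Y orbT.
(* The new point is lowest for [l]; were [l] neither [j] nor [k], the former
   lowest point for [l] would no longer be lowest for any colour. *)
have ljk : (l == j) || (l == k).
  apply/negPn/negP; rewrite negb_or => /andP[lj lk].
  have [i' e le] := dm l; have [il|il] := eqVneq i' l.
    by move: ltl; rewrite ltnNge -{1}il -{1}il il; move: le; rewrite il => ->.
  have [ij|ij] := eqVneq i' j.
    by move: il; rewrite (injk i' l) ?eqxx ?inE // ij.
  by move: il; rewrite (injj i' l) ?eqxx ?inE.
suff fin a : {in [set~ a] &, injective m} -> l = a -> x = best a.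
  by case/orP: ljk => /eqP la; rewrite -(fin _ _ la) ?eqxx ?orbT.
move=> inja la; subst a.
have xM : x \in M l.
  apply/MP => i il; have [i' e le] := dm i.
  have i'l : i' != l.
    by apply: contraTneq ltl => i'l; rewrite -leqNgt -{1}i'l -[in m l]i'l e -i'l.
  rewrite (inja i' i) ?inE // in le.
  rewrite ltn_neqAle le andbT (inj_eq (@ht_inj _)).
  by apply: contraNneq xY => <-.
apply: (@ht_inj l); apply/eqP; rewrite eqn_leq bmax //= leqNgt; apply/negP => lt.
have [i h] := dx (best l); have [il|il] := eqVneq i l.
  by have := h x; rewrite !inE eqxx il leqNgt lt => /(_ isT).
have := h (m i); rewrite !inE mY orbT leqNgt => /(_ isT)/negP; apply.
exact: (MP _ _ (bM l)).
Qed.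

(** Double counting of the pairs (room, door without the colour [i0]): the
    outer door is the only one with an odd number of rooms, so some room has an
    odd number of such doors, and this room carries all colours. *)
Lemma scarf (i0 : I) : (exists x, x \notin codom s) ->
  exists X : {set P}, dominant X /\ c @: X = [set: I].
Proof.
move=> x0.
have [/existsP[X /and3P[dX _ /eqP cX]]|none] :=
  boolP [exists X : {set P}, [&& dominant X, #|X| == #|I| & c @: X == [set: I]]].
  by exists X.
pose A := [set z : {set P} * P | [&& #|z.1| == #|I|, dominant z.1, z.2 \in z.1
            & c @: (z.1 :\ z.2) == [set~ i0]]].
pose B := [set z : {set P} * P | [&& #|z.1|.+1 == #|I|, c @: z.1 == [set~ i0],
            z.2 \notin z.1 & dominant (z.2 |: z.1)]].
have AB : #|A| = #|B|.
  have <- : (fun z => (z.1 :\ z.2, z.2)) @: A = B; last first.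
    rewrite card_in_imset // => -[X x] [X' x']; rewrite !inE /=.
    move=> /and4P[_ _ xX _] /and4P[_ _ xX' _] [e ex]; subst x'.
    by rewrite -(setD1K xX) e setD1K.
  apply/setP => -[Y y]; rewrite !inE /=; apply/imsetP/and4P.
    move=> [[X x]]; rewrite !inE /= => /and4P[cX dX xX col] [-> ->].
    by rewrite !inE eqxx setD1K // -(eqP cX) (cardsD1 x X) xX.
  move=> [cY colY yY dY]; exists (y |: Y, y); rewrite ?inE /= ?eqxx ?setU1K //.
  by rewrite cardsU1 yY dY colY add1n cY.
have evA : ~~ odd #|A|.
  rewrite -sum1_card (eq_bigl (fun z : {set P} * P => ((#|z.1| == #|I|) && dominant z.1)
     && ((z.2 \in z.1) && (c @: (z.1 :\ z.2) == [set~ i0])))); last first.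
    by move=> z; rewrite !inE -!andbA.
  rewrite -(pair_big_dep (fun X : {set P} => (#|X| == #|I|) && dominant X)
     (fun (X : {set P}) x => (x \in X) && (c @: (X :\ x) == [set~ i0])) (fun _ _ => 1)) /=.
  elim/big_ind: _ => // [a b ea eb|X /andP[/eqP cX dX]].
    by rewrite oddD (negbTE ea).
  rewrite sum1dep_card; apply: room_even => //; apply: contra none => col.
  by apply/existsP; exists X; rewrite dX cX eqxx.
pose Y0 := s @: [set~ i0].
have Y0P : (#|Y0|.+1 == #|I|) && (c @: Y0 == [set~ i0]).
  apply/andP; split.
    rewrite card_imset ?cardsC1; last exact: can_inj sK.
    by rewrite prednK //; apply/card_gt0P; exists i0.
  by rewrite -imset_comp (eq_imset _ sK) imset_id.
suff : odd #|B| by rewrite -AB (negbTE evA).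
rewrite -sum1_card (eq_bigl (fun z : {set P} * P => ((#|z.1|.+1 == #|I|) && (c @: z.1 == [set~ i0]))
   && ((z.2 \notin z.1) && dominant (z.2 |: z.1)))); last first.
  by move=> z; rewrite !inE -!andbA.
rewrite -(pair_big_dep (fun Y : {set P} => (#|Y|.+1 == #|I|) && (c @: Y == [set~ i0]))
   (fun (Y : {set P}) y => (y \notin Y) && dominant (y |: Y)) (fun _ _ => 1)) /=.
rewrite (bigD1 Y0) //= oddD sum1dep_card outer_door_odd //=.
elim/big_ind: _ => // [a b ea eb|Y /andP[/andP[/eqP cY /eqP colY] nY]].
  by rewrite oddD (negbTE ea).
rewrite sum1dep_card; apply: door_even => //; apply: contra nY => /subsetP sub.
apply/eqP/setP => y; apply/idP/imsetP => [yY|[i + ->]].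
  have /codomP[i e] := sub _ yY; exists i => //.
  by rewrite -colY -[i]sK -e imset_f.
rewrite -colY => /imsetP[z zY ->]; have /codomP[i' e] := sub _ zY.
by rewrite e sK -e.
Qed.
End Scarf.

(** * Fine grids of the simplex *)

Section Grid.
Variables (n m : nat).
Notation grid_pt := {ffun 'I_n.+1 -> 'I_m.+1}.
Definition on_grid (x : grid_pt) := \sum_i x i == m.

Let T : finType := {x : grid_pt | on_grid x}.
Let I : finType := 'I_n.+1.

Let corner : grid_pt := [ffun i => if i == ord0 then ord_max else ord0].
Lemma on_grid_corner : on_grid corner.
Proof.
rewrite /on_grid (bigD1 ord0) //= !ffunE eqxx /= big1 ?addn0 // => i ni.
by rewrite ffunE (negbTE ni).
Qed.

Let t0 : T := Sub corner on_grid_corner.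

(** Ties between grid points with the same [i]-th coordinate are broken by
    [enum_rank]; [inr j] is the slack point of colour [j]. *)
Let ht (i : I) (p : T + I) : nat :=
  match p with
  | inl x => (val x i * #|T| + enum_rank x).+1
  | inr j => if j == i then 0 else (m.+1 * #|T| + j).+1
  end.

Let ht_lt i (x : T) j : j != i -> ht i (inl x) < ht i (inr j).
Proof.
move=> /negbTE ji; rewrite /ht ji ltnS.
have h : val x i * #|T| + #|T| <= m.+1 * #|T|.
  by rewrite addnC -mulSn leq_mul2r ltn_ord orbT.
by apply: leq_trans (leq_addr _ _); apply: leq_trans h; rewrite ltn_add2l.
Qed.

Let ht_le i (x y : T) : ht i (inl x) <= ht i (inl y) -> val x i <= val y i.
Proof.
rewrite /ht ltnS => h; rewrite leqNgt; apply/negP => lt.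
have lt2 : (val y i).+1 * #|T| <= val x i * #|T| by rewrite leq_mul2r lt orbT.
move: h; apply/negP; rewrite -ltnNge; apply: leq_trans (leq_addr _ _).
by apply: leq_trans lt2; rewrite mulSn addnC ltn_add2r.
Qed.

Let ht_inj i : injective (ht i).
Proof.
case=> [x|j] [y|k] //=.
- move=> e; have exy : val x i = val y i :> nat.
    by apply/eqP; rewrite eqn_leq !ht_le //= e.
  by move: e; rewrite exy => -[/addnI/ord_inj/enum_rank_inj->].
- by have [->//|ki] := eqVneq k i; have := ht_lt x ki; rewrite /ht (negbTE ki) => + e; rewrite e ltnn.
- by have [->//|ki] := eqVneq j i; have := ht_lt y ki; rewrite /ht (negbTE ki) => + e; rewrite e ltnn.
have [->|ji] := eqVneq j i; have [->|ki] := eqVneq k i => //.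
by move=> -[/addnI/ord_inj->].
Qed.

(** The points [x / m] and [xs i / m] are within [(n + 1) / m] of each other, and
    [xs i] carries the label [i] unless its [i]-th coordinate is negligible. *)
Lemma sperner_grid (c : grid_pt -> 'I_n.+1) :
  exists x : grid_pt, exists xs : 'I_n.+1 -> grid_pt,
    on_grid x /\ forall i,
    [/\ on_grid (xs i),
        forall j, x j <= xs i j + n.+1 /\ xs i j <= x j + n.+1
      & c (xs i) = i \/ xs i i <= n.+1].
Proof.
pose col (p : T + I) : I := match p with inl x => c (val x) | inr j => j end.
have notslack (x : T) : inl x \notin codom (@inr T I) by apply/negP => /codomP[].
have [||//||X [/dominantP dX colX]] := @scarf _ _ ht inr col ht_inj _ _ _ ord0.
- by move=> i p; rewrite /= eqxx.
- move=> i j [x|k] ji; first by rewrite ht_lt.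
  by rewrite codom_f.
- by exists (inl t0).
pose C := [set i : I | inr i \notin X].
have dom (y : T) : exists2 i, i \in C & forall x : T, inl x \in X -> val y i <= val x i.
  have [i h] := dX (inl y); exists i => [|x /h/ht_le//].
  by rewrite inE; apply/negP => /h; rewrite /= eqxx.
have lab i : i \in C -> exists2 x : T, inl x \in X & c (val x) = i.
  rewrite inE => iC; have : i \in col @: X by rewrite colX.
  move=> /imsetP[[x|j] pX e]; first by exists x.
  by rewrite e /= pX in iC.

have [i1 i1C _] := dom t0.
have [x0 x0X _] := lab i1 i1C.
pose a (i : I) : nat := val [arg min_(x < x0 | inl x \in X) (val x i : nat)] i.
have aX (i : I) : exists2 x : T, inl x \in X & val x i = a i :> nat.
  by rewrite /a; case: arg_minnP => // x xX _; exists x.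
have amin (i : I) (x : T) : inl x \in X -> a i <= val x i.
  by move=> xX; rewrite /a; case: arg_minnP => // y _; apply.
(* Otherwise some grid point would exceed the minima [a i] in all the
   coordinates of [C], against dominance. *)
have big_a : m < \sum_(i in C) (a i).+1.
  rewrite ltnNge; apply/negP => le.
  have lei i : i \in C -> (a i).+1 <= m.
    by move=> iC; apply: leq_trans le; rewrite (bigD1 i) //= leq_addr.
  (* The coordinate [i1] receives what is left of the total mass [m]. *)
  pose b i : nat := if i == i1 then m - \sum_(i in C | i != i1) (a i).+1
                    else if i \in C then (a i).+1 else 0.
  have bm i : b i <= m.
    rewrite /b; case: eqP => _; first exact: leq_subr.
    by case: ifP => // /lei.
  pose y : grid_pt := [ffun i => inord (b i)].
  have yE i : y i = b i :> nat by rewrite ffunE inordK // ltnS.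
  have le1 : \sum_(i in C | i != i1) (a i).+1 <= m.
    by apply: leq_trans le; rewrite [leqRHS](bigD1 i1) //= leq_addl.
  have yT : on_grid y.
    rewrite /on_grid (bigD1 i1) //= yE {1}/b eqxx.
    rewrite (_ : \sum_(i | i != i1) y i = \sum_(i in C | i != i1) (a i).+1) ?subnK //.
    rewrite [RHS]big_mkcondl /=; apply: eq_bigr => i ni.
    by rewrite yE /b (negbTE ni).
  have [i iC h] := dom (Sub y yT); have [x xX ax] := aX i.
  have := h x xX; rewrite ax /= yE /b; case: eqP => [->|_]; last by rewrite iC ltnn.
  have := le; rewrite (bigD1 i1) //= => le' h'.
  have := leq_sub2r (\sum_(i in C | i != i1) (a i).+1) le'.
  by rewrite addnK leqNgt ltnS h'.
pose a' i := if i \in C then a i else 0.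
have a'le (x : T) j : inl x \in X -> a' j <= val x j <= a' j + n.+1.
  move=> xX; have le i : a' i <= val x i by rewrite /a'; case: ifP => // _; exact: amin.
  rewrite le /=.
  have hsum : \sum_i (val x i : nat) = m by apply/eqP/(valP x).
  have : \sum_i (val x i : nat) <= \sum_i a' i + #|C|.
    by rewrite hsum -big_mkcond /= -sum1_card -big_split /= ltnW // (eq_bigr _ (fun i _ => addn1 (a i))).
  rewrite (bigD1 j) //= [in leqRHS](bigD1 j) //=.
  have : \sum_(i | i != j) a' i <= \sum_(i | i != j) (val x i : nat).
    by apply: leq_sum => i _; exact: le.
  have := max_card (mem C); rewrite card_ord.
  move: (\sum_(i | _) _) (\sum_(i | _) _) #|C| => A B D; lia.
exists (val x0), (fun i => if [pick x : T | (inl x \in X) && (c (val x) == i)] is Some x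
   then val x else val x0); split; first exact: valP.
move=> i; case: pickP => [x /andP[xX /eqP cx]|none]; split.
- exact: valP.
- move=> j; have /andP[l1 l2] := a'le x j xX; have /andP[l3 l4] := a'le x0 j x0X.
  by split; [apply: leq_trans l4 _|apply: leq_trans l2 _]; rewrite leq_add2r.
- by left.
- exact: valP.
- by move=> j; rewrite leq_addr.
- right; have [/lab[x xX cx]|iC] := boolP (i \in C).
    by have := none x; rewrite xX cx eqxx.
  by have /andP[_] := a'le x0 i x0X; rewrite /a' (negbTE iC).
Qed.
End Grid.

From mathcomp Require Import all_classical all_reals all_analysis.

Import Order.TTheory GRing.Theory Num.Theory.
Import numFieldNormedType.Exports.

Local Open Scope classical_set_scope.
Local Open Scope ring_scope.

(** * Continuity, compactness and ultrafilter limits *)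

Lemma continuous_fcomp (X Y Z : topologicalType) (f : X -> Y) (g : Y -> Z) :
  continuous f -> continuous g -> continuous (fun x => g (f x)).
Proof. by move=> fc gc x; apply: continuous_comp; [exact: fc|exact: gc]. Qed.

Lemma continuous_fpair (X Y Z : topologicalType) (f : X -> Y) (g : X -> Z) :
  continuous f -> continuous g -> continuous (fun x => (f x, g x)).
Proof. move=> fc gc x; exact: (cvg_pair (fc x) (gc x)). Qed.

Section Topology.
Variable R : realType.

Lemma fmap_ultra (T U : Type) (f : T -> U) (F : set_system T) :
  UltraFilter F -> UltraFilter (f @ F).
Proof.
move=> FU; split; first exact: fmap_proper_filter.
move=> G GF FG; rewrite eqEsubset; split => // A GA.
have [//|FA] := in_ultra_setVsetC (f @^-1` A) FU.
have GnA : G (~` A) by apply: FG.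
by have /filter_ex[x []] : G (A `&` ~` A) by exact: filterI.
Qed.

(** An ultrafilter replaces the extraction of subsequences: it makes all bounded
    sequences converge at once, in particular the values of a sequence of
    functions at every point of an interval. *)
Lemma ultra_nat : exists U : set_system nat, UltraFilter U /\ \oo `<=` U.
Proof. exact: ultraFilterLemma. Qed.

Lemma ultra_compact (T : Type) (V : topologicalType) (F : set_system T)
    (K : set V) (x : T -> V) :
  UltraFilter F -> compact K -> (\forall t \near F, K (x t)) ->
  exists l, K l /\ x @ F --> l.
Proof.
move=> FU; rewrite compact_ultra => cK Kx.
by have [l [Kl xl]] := cK (x @ F) (fmap_ultra x FU) Kx; exists l.
Qed.

Lemma mx_norm_le m n (x : 'M[R]_(m, n)) (c : R) : 0 <= c ->
  (forall i j, `|x i j| <= c) -> `|x| <= c.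
Proof.
move=> c0 h; rewrite [leLHS]/Num.Def.normr /= mx_normrE.
by apply: bigmax_le => // -[i j] _; exact: h.
Qed.

Lemma rV_norm_le n (x : 'rV[R]_n) (c : R) : 0 <= c ->
  (forall i, `|x 0 i| <= c) -> `|x| <= c.
Proof. by move=> c0 h; apply: mx_norm_le => // i j; rewrite (ord1 i). Qed.

Lemma rV_coord_le n (x : 'rV[R]_n) i : `|x 0 i| <= `|x|.
Proof.
rewrite [leRHS]/Num.Def.normr /= mx_normrE.
by apply/bigmax_geP; right; exists (0, i).
Qed.

Lemma mx_cvg (T : Type) (F : set_system T) m n (f : T -> 'M[R]_(m, n)) (l : 'M[R]_(m, n)) :
  Filter F -> (forall i j, f t i j @[t --> F] --> l i j) -> f t @[t --> F] --> l.
Proof.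
move=> FF h; apply/cvgrPdist_le => e e0.
have : \forall t \near F, forall i j, `|l i j - f t i j| <= e.
  by apply: filter_forall => i; apply: filter_forall => j; move/cvgrPdist_le : (h i j); exact.
apply: filterS => t ht; apply: mx_norm_le; first exact: ltW.
by move=> i j; rewrite !mxE.
Qed.

Lemma rV_cvg (T : Type) (F : set_system T) n (f : T -> 'rV[R]_n) (l : 'rV[R]_n) :
  Filter F -> (forall i, f t 0 i @[t --> F] --> l 0 i) -> f t @[t --> F] --> l.
Proof. by move=> FF h; apply: mx_cvg => i j; rewrite (ord1 i). Qed.

Lemma rV_cvg_coord (T : Type) (F : set_system T) n (f : T -> 'rV[R]_n) (l : 'rV[R]_n) i :
  Filter F -> f t @[t --> F] --> l -> f t 0 i @[t --> F] --> l 0 i.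
Proof. move=> FF h; exact: cvg_comp h (@coord_continuous R _ n 0 i l). Qed.

Lemma rV_continuous (X : topologicalType) n (f : X -> 'rV[R]_n) :
  (forall i, continuous (fun x => f x 0 i)) -> continuous f.
Proof. by move=> h x; apply: rV_cvg => i; exact: h. Qed.

Lemma mx_continuous (X : topologicalType) m n (f : X -> 'M[R]_(m, n)) :
  (forall i j, continuous (fun x => f x i j)) -> continuous f.
Proof. by move=> h x; apply: mx_cvg => i j; exact: h. Qed.

Lemma continuous_coord (X : topologicalType) n (f : X -> 'rV[R]_n) i :
  continuous f -> continuous (fun x => f x 0 i).
Proof. by move=> h x; apply: rV_cvg_coord; exact: h. Qed.

Lemma sum_continuous (X : topologicalType) (I : finType) (P : pred I) (f : I -> X -> R) :
  (forall i, continuous (f i)) -> continuous (fun x => \sum_(i | P i) f i x).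
Proof. by move=> h; apply: continuous_big => [|i _]; [exact: add_continuous|exact: h]. Qed.

Lemma compact_simplex n : compact (@simplex R n).
Proof.
have -> : @simplex R n = [set v : 'rV[R]_n | forall i, `[0, 1]%classic (v 0 i)] `&`
    (fun v : 'rV[R]_n => \sum_(k < n) v 0 k) @^-1` [set 1].
  apply/seteqP; split => [v [v0 v1]|v [h v1]]; last first.
    by split => // k; have /= := h k; rewrite in_itv /= => /andP[].
  split => // k /=; rewrite in_itv /= v0 -v1 (bigD1 k) //= lerDl.
  by apply: sumr_ge0 => i _; exact: v0.
apply: compact_closedI.
  by apply: (@rV_compact R n (fun=> `[0, 1]%classic)) => _; exact: segment_compact.
apply: (@preimage_closed _ _ (fun v : 'rV[R]_n => \sum_k v 0 k)); last exact: closed_eq.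
move=> v _; apply: (@sum_continuous _ _ _ (fun i (w : 'rV[R]_n) => w 0 i)) => i.
exact: coord_continuous.
Qed.

Lemma simplex_le1 n (x : 'rV[R]_n) i : simplex x -> x 0 i <= 1.
Proof.
by move=> [x0 <-]; rewrite (bigD1 i) //= lerDl sumr_ge0 // => j _; exact: x0.
Qed.

Section Arithmetic.
Variables (X : topologicalType) (f k : X -> R).
Hypotheses (fc : continuous f) (kc : continuous k).

Lemma continuous_fD : continuous (fun x => f x + k x).
Proof. by move=> x; exact: (@cvgD R R^o X (nbhs x) _ f k _ _ (@fc x) (@kc x)). Qed.

Lemma continuous_fB : continuous (fun x => f x - k x).
Proof. by move=> x; exact: (@cvgB R R^o X (nbhs x) _ f k _ _ (@fc x) (@kc x)). Qed.

Lemma continuous_fM : continuous (fun x => f x * k x).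
Proof. by move=> x; exact: (@cvgM R X (nbhs x) _ f k _ _ (@fc x) (@kc x)). Qed.

Lemma continuous_fmax : continuous (fun x => Num.max (f x) (k x)).
Proof. by move=> x; exact: (continuous_max (@fc x) (@kc x)). Qed.

Lemma continuous_fdiv : (forall x, k x != 0) -> continuous (fun x => f x / k x).
Proof.
move=> k0 x; apply: (@cvgM R X (nbhs x) _ f (fun y => (k y)^-1) _ _ (@fc x)).
exact: (@cvgV R X (nbhs x) _ k _ (k0 x) (@kc x)).
Qed.

End Arithmetic.
End Topology.

(** * The fixed point theorem on simplices and on their products *)

Section Brouwer.
Variable R : realType.

(** The label of a grid point [x] is a coordinate that [F] does not decrease; one
    exists because [x] and [F x] have the same total mass. *)
Lemma brouwer_approx n (F : 'rV[R]_n.+1 -> 'rV[R]_n.+1) (m : nat) :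
  (forall x, simplex x -> simplex (F x)) ->
  let d := n.+1%:R / m.+1%:R : R in
  exists x : 'rV[R]_n.+1, exists xs : 'I_n.+1 -> 'rV[R]_n.+1,
    simplex x /\ forall i, [/\ simplex (xs i), `|xs i - x| <= d
      & xs i 0 i - d <= F (xs i) 0 i].
Proof.
move=> FS d.
pose pt (x : {ffun 'I_n.+1 -> 'I_m.+2}) : 'rV[R]_n.+1 :=
  \row_i ((x i : nat)%:R / m.+1%:R).
have m0 : 0 < m.+1%:R :> R by rewrite ltr0n.
have ptS x : on_grid x -> simplex (pt x).
  move=> /eqP h; split => [i|]; first by rewrite mxE divr_ge0.
  under eq_bigr do rewrite mxE.
  by rewrite -mulr_suml -natr_sum h divff // gt_eqF.
pose c (x : {ffun 'I_n.+1 -> 'I_m.+2}) : 'I_n.+1 :=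
  odflt ord0 [pick i | pt x 0 i <= F (pt x) 0 i].
have cP x : on_grid x -> pt x 0 (c x) <= F (pt x) 0 (c x).
  move=> /ptS xS; rewrite /c; case: pickP => //= none.
  have : \sum_i F (pt x) 0 i < \sum_i pt x 0 i.
    apply: ltr_sum => [|i _]; last by rewrite ltNge none.
    by apply/hasP; exists ord0; rewrite // mem_index_enum.
  by rewrite (FS _ xS).2 xS.2 ltxx.
have [x [xs [xg h]]] := sperner_grid c.
exists (pt x), (fun i => pt (xs i)); split; first exact: ptS.
move=> i; have [ig near lab] := h i; split; first exact: ptS.
  apply: rV_norm_le => [|j]; first by rewrite divr_ge0.
  rewrite !mxE -mulrBl normrM [`|_^-1|]ger0_norm ?invr_ge0 ?ler0n //.
  rewrite ler_pM2r ?invr_gt0 // ler_norml; have [n1 n2] := near j.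
  apply/andP; split; first by rewrite lerBrDl lerBlDr -natrD ler_nat n1.
  by rewrite lerBlDr -natrD ler_nat addnC n2.
case: lab => [ci|small].
  apply: (@le_trans _ _ (pt (xs i) 0 i)); first by rewrite lerBlDr lerDl divr_ge0.
  by have := cP _ ig; rewrite ci.
apply: (@le_trans _ _ 0); last exact: (FS _ (ptS _ ig)).1.
by rewrite mxE subr_le0 ler_pM2r ?invr_gt0 // ler_nat.
Qed.

Lemma cvg_natr_inv (k : R) : k / m.+1%:R @[m --> \oo] --> (0 : R).
Proof. by rewrite -[X in _ --> X](mulr0 k); apply: cvgM; [exact: cvg_cst|exact: cvg_harmonic]. Qed.

(** In the limit no coordinate is decreased by [F], and both sides sum to 1. *)
Theorem brouwer_simplex n (F : 'rV[R]_n.+1 -> 'rV[R]_n.+1) :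
  continuous F -> (forall x, simplex x -> simplex (F x)) ->
  exists x, simplex x /\ F x = x.
Proof.
move=> Fc FS.
have /choice[X hX] := fun m => brouwer_approx m FS.
have [XS {hX}h] := choice hX.
have [U [UU Uoo]] := ultra_nat.
have [x [xS Xx]] := ultra_compact UU (@compact_simplex R n.+1)
  (@filterE _ U _ _ (fun m => (h m).1)).
exists x; split => //.
have d0 : (n.+1%:R / m.+1%:R : R) @[m --> U] --> (0 : R).
  by move=> A hA; apply: Uoo; exact: (cvg_natr_inv n.+1%:R hA).
have XSx i : XS m i @[m --> U] --> x.
  apply/cvgrPdist_le => e e0.
  have e2 : 0 < e / 2 by rewrite divr_gt0.
  move/cvgrPdist_le : Xx => /(_ _ e2) near1.
  move/cvgrPdist_le : d0 => /(_ _ e2) near2.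
  apply: filterS2 near1 near2 => m l1 l2; have [_ dm _] := (h m).2 i.
  rewrite (splitr e) -(subrKA (X m)); apply: le_trans (ler_normD _ _) _.
  apply: lerD => //; rewrite distrC; apply: le_trans dm _.
  apply: le_trans (ler_norm _) _.
  by move: l2; rewrite sub0r normrN.
have Fge i : x 0 i <= F x 0 i.
  have c1 : F (XS m i) 0 i @[m --> U] --> F x 0 i.
    by apply: rV_cvg_coord; apply: cvg_comp (XSx i) (Fc x).
  have c2 : (XS m i 0 i - n.+1%:R / m.+1%:R) @[m --> U] --> x 0 i - 0.
    by apply: cvgB d0; apply: rV_cvg_coord; exact: XSx.
  rewrite -[leLHS]subr0; apply: (ler_cvg_to c2 c1).
  by apply: filterE => m; have [_ _] := (h m).2 i.
have sum0 : \sum_i (F x 0 i - x 0 i) = 0.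
  by rewrite sumrB (FS _ xS).2 xS.2 subrr.
apply/rowP => i; apply/eqP; rewrite -subr_eq0; apply/eqP.
by apply: (psumr_eq0P _ sum0) => // j _; rewrite subr_ge0.
Qed.

Section Retraction.
Variables (N : nat) (c0 : 'rV[R]_N).
Hypothesis c0S : simplex c0.

Let mass (x : 'rV[R]_N) : R := \sum_i Num.max (x 0 i) 0.

(** A continuous retraction onto the simplex: the negative coordinates are cut
    off, then a mass above 1 is normalised and a mass below 1 is completed by a
    multiple of the distribution [c0]. *)
Definition retract (x : 'rV[R]_N) : 'rV[R]_N :=
  \row_i ((Num.max (x 0 i) 0 + Num.max (1 - mass x) 0 * c0 0 i) / Num.max (mass x) 1).

Lemma retract_simplex x : simplex (retract x).
Proof.
have m1 : 0 < Num.max (mass x) 1 by rewrite lt_max ltr01 orbT.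
split => [i|].
  rewrite mxE divr_ge0 ?(ltW m1) // addr_ge0 ?le_max ?lexx ?orbT //.
  by rewrite mulr_ge0 ?c0S.1 // le_max lexx orbT.
under eq_bigr do rewrite mxE.
rewrite -mulr_suml big_split /= -mulr_sumr c0S.2 mulr1 -/(mass x).
apply: (mulIf (lt0r_neq0 m1)); rewrite mul1r divfK ?gt_eqF //.
have [h|/ltW h] := leP 1 (mass x).
  by rewrite max_r ?subr_le0 // addr0.
by rewrite max_l ?subr_ge0 // addrC subrK.
Qed.

Lemma retract_id x : simplex x -> retract x = x.
Proof.
move=> [x0 x1]; have xmax i : Num.max (x 0 i) 0 = x 0 i by apply: max_l; exact: x0.
have mx1 : mass x = 1 by rewrite /mass; under eq_bigr do rewrite xmax.
by apply/rowP => i; rewrite mxE xmax mx1 subrr !maxxx mul0r addr0 divr1.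
Qed.

Lemma retract_continuous : continuous retract.
Proof.
have cst c : continuous (fun _ : 'rV[R]_N => c : R) by exact: cst_continuous.
have pos i : continuous (fun x : 'rV[R]_N => Num.max (x 0 i) 0).
  by apply: (continuous_fmax (f := fun x : 'rV[R]_N => x 0 i) _ (cst 0)); exact: coord_continuous.
have mc : continuous mass.
  exact: (@sum_continuous _ _ _ _ (fun i (x : 'rV[R]_N) => Num.max (x 0 i) 0)).
apply: rV_continuous => i; rewrite (_ : (fun x => _) = (fun x : 'rV[R]_N =>
    (Num.max (x 0 i) 0 + Num.max (1 - mass x) 0 * c0 0 i) / Num.max (mass x) 1)).
  apply: continuous_fdiv.
  - apply: continuous_fD; first exact: pos.
    apply: continuous_fM (cst _).
    exact: continuous_fmax (continuous_fB (cst 1) mc) (cst 0).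
  - exact: continuous_fmax mc (cst 1).
  - by move=> x; rewrite gt_eqF // lt_max ltr01 orbT.
by apply/funext => x; rewrite mxE.
Qed.

End Retraction.

(** A product of [K] simplices of dimension [N - 1], scaled by [1 / K], is
    a retract of the simplex with [K * N] vertices. *)
Lemma brouwer_simplices K N (Phi : 'M[R]_(K, N) -> 'I_K -> 'rV[R]_N) (c0 : 'rV[R]_N) :
  simplex c0 -> (forall k, continuous (Phi ^~ k)) ->
  (forall p k, (forall k', simplex (row k' p)) -> simplex (Phi p k)) ->
  exists p, forall k, simplex (row k p) /\ Phi p k = row k p.
Proof.
case: K Phi => [|K] Phi c0S Pc PS; first by exists 0 => -[].
case: N c0 Phi c0S Pc PS => [|N] c0 Phi c0S Pc PS.
  by have := c0S.2; rewrite big_ord0 => /esym/eqP; rewrite oner_eq0.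
pose proj (x : 'rV[R]_(K.+1 * N.+1)) : 'M[R]_(K.+1, N.+1) :=
  \matrix_(k, i) retract c0 (K.+1%:R *: row k (vec_mx x)) 0 i.
have projE x k : row k (proj x) = retract c0 (K.+1%:R *: row k (vec_mx x)).
  by apply/rowP => i; rewrite !mxE.
have projS x k : simplex (row k (proj x)) by rewrite projE; exact: retract_simplex.
pose F (x : 'rV[R]_(K.+1 * N.+1)) : 'rV[R]_(K.+1 * N.+1) :=
  mxvec (\matrix_(k, i) (Phi (proj x) k 0 i / K.+1%:R)).
have K0 : K.+1%:R != 0 :> R by rewrite pnatr_eq0.
have projc : continuous proj.
  apply: mx_continuous => k i; rewrite (_ : (fun x => _) =
      (fun x => retract c0 (K.+1%:R *: row k (vec_mx x)) 0 i)); last first.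
    by apply/funext => x; rewrite mxE.
  pose sc (y : 'rV[R]_(K.+1 * N.+1)) := K.+1%:R *: row k (vec_mx y).
  have scc : continuous sc.
    apply: rV_continuous => j; rewrite (_ : (fun _ => _) =
      (fun y : 'rV[R]_(K.+1 * N.+1) => K.+1%:R * y 0 (mxvec_index k j))).
      by apply: continuous_fM; [exact: cst_continuous|exact: coord_continuous].
    by apply/funext => y; rewrite !mxE.
  exact: continuous_coord (continuous_fcomp scc (@retract_continuous _ c0)).
have Fc : continuous F.
  apply: rV_continuous => j; case/mxvec_indexP: j => k i.
  rewrite (_ : (fun x => _) = (fun x => Phi (proj x) k 0 i / K.+1%:R)); last first.
    by apply/funext => x; rewrite mxvecE mxE.
  apply: continuous_fM; last exact: cst_continuous.
  exact: continuous_coord (continuous_fcomp projc (Pc k)).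
have FS x : simplex (F x).
  have PhS k : simplex (Phi (proj x) k) by apply: PS.
  split => [j|].
    by case/mxvec_indexP: j => k i; rewrite mxvecE mxE divr_ge0 // (PhS k).1.
  transitivity (\sum_(p : 'I_K.+1 * 'I_N.+1) F x 0 (mxvec_index p.1 p.2)).
    by rewrite (reindex _ (curry_mxvec_bij _ _)) /=; apply: eq_bigr => -[].
  rewrite -(pair_bigA _ (fun k i => F x 0 (mxvec_index k i))) /=.
  under eq_bigr => k _.
    under eq_bigr do rewrite mxvecE mxE.
    rewrite -mulr_suml (PhS k).2 mul1r; over.
  by rewrite sumr_const card_ord -[LHS]mulr_natl divff.
have [x [xS xF]] : exists x : 'rV[R]_(K.+1 * N.+1), simplex x /\ F x = x.
  exact: (brouwer_simplex Fc (fun x _ => FS x)).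
have {xF}Fx : x = F x by [].
exists (proj x) => k; split => //; rewrite projE.
have -> : K.+1%:R *: row k (vec_mx x) = Phi (proj x) k.
  by apply/rowP => i; rewrite [in LHS]Fx mxvecK !mxE mulrC divfK.
by rewrite retract_id //; apply: PS.
Qed.
End Brouwer.

(** * The time-discretised forward-backward system *)

Section Scheme.
Variables (R : realType) (N : nat).
Notation state := ('rV[R]_N * 'rV[R]_N)%type.
Variables (b : 'I_N -> state -> R) (a : 'I_N -> 'I_N -> state -> R).
Variable (g : 'I_N -> 'rV[R]_N -> R).

(** Net inflow of mass at the node [i] when [a j i] is the jump rate from [j] to
    [i]; a [state] is a pair (values, distribution). *)
Definition drift (i : 'I_N) (z : state) : R :=
  \sum_j a j i z * z.2 0 j - (\sum_j a i j z) * z.2 0 i.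

Section Discrete.
Variables (h : R) (K : nat) (c0 : 'rV[R]_N).

Definition value_step (u m : 'rV[R]_N) : 'rV[R]_N := \row_i (u 0 i + h * b i (u, m)).

Definition mass_step (z : state) (w : 'rV[R]_N) : 'rV[R]_N :=
  \row_i (w 0 i + h * (\sum_j a j i z * w 0 j - (\sum_j a i j z) * w 0 i)).

Section Path.
Variable p : 'M[R]_(K.+1, N).
Definition path_at (k : nat) : 'rV[R]_N := row (inord k) p.

(** [value_to_go l] is the value function [l] steps before the final time. *)
Fixpoint value_to_go (l : nat) : 'rV[R]_N :=
  if l is l'.+1 then value_step (value_to_go l') (path_at (K - l'))
  else \row_i g i (path_at K).

Fixpoint mass_response (k : nat) : 'rV[R]_N :=
  if k is k'.+1 then mass_step (value_to_go (K - k'), path_at k') (mass_response k')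
  else c0.
End Path.

Hypotheses (bc : forall i, continuous (b i)) (ac : forall i j, continuous (a i j)).
Hypothesis gc : forall i, continuous (g i).

Lemma path_at_continuous k : continuous (path_at ^~ k).
Proof.
apply: rV_continuous => i; rewrite (_ : (fun _ => _) = fun p : 'M[R]_(K.+1, N) => p (inord k) i).
  exact: coord_continuous.
by apply/funext => p; rewrite mxE.
Qed.

Lemma value_to_go_continuous l : continuous (value_to_go ^~ l).
Proof.
elim: l => [|l IH]; apply: rV_continuous => i.
  rewrite (_ : (fun _ => _) = fun p => g i (path_at p K)).
    exact: continuous_fcomp (@path_at_continuous K) (@gc i).
  by apply/funext => p; rewrite mxE.
rewrite (_ : (fun _ => _) = fun p => value_to_go p l 0 i
    + h * b i (value_to_go p l, path_at p (K - l)%N)); last by apply/funext => p; rewrite mxE.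
apply: continuous_fD; first exact: continuous_coord.
apply: continuous_fM; first exact: cst_continuous.
exact: continuous_fcomp (continuous_fpair IH (@path_at_continuous (K - l)%N)) (@bc i).
Qed.

Lemma mass_response_continuous k : continuous (mass_response ^~ k).
Proof.
elim: k => [|k IH]; first exact: cst_continuous.
apply: rV_continuous => i.
pose z p : state := (value_to_go p (K - k)%N, path_at p k).
have zc : continuous z.
  by apply: continuous_fpair; [exact: value_to_go_continuous|exact: path_at_continuous].
have azc i' j : continuous (fun p => a i' j (z p)) by exact: continuous_fcomp zc (@ac i' j).
have wc j : continuous (fun p => mass_response p k 0 j) by exact: continuous_coord.
rewrite (_ : (fun _ => _) = fun p => mass_response p k 0 i
    + h * (\sum_j a j i (z p) * mass_response p k 0 j
           - (\sum_j a i j (z p)) * mass_response p k 0 i)); last first.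
  by apply/funext => p; rewrite mxE.
apply: continuous_fD => //.
apply: continuous_fM; first exact: cst_continuous.
apply: continuous_fB.
  apply: (@sum_continuous _ _ _ _ (fun j p => a j i (z p) * mass_response p k 0 j)) => j.
  exact: continuous_fM.
apply: continuous_fM => //.
exact: (@sum_continuous _ _ _ _ (fun j p => a i j (z p))).
Qed.

(** [C] bounds the values along the whole backward recursion, which starts below
    [G] and grows by at most [h * F] per step; [Lam] bounds the total jump rate
    out of a node as long as the values stay below [C]. *)
Variables (C G F Lam : R).
Hypotheses (h_gt0 : 0 < h) (F_ge0 : 0 <= F) (c0S : simplex c0).
Hypothesis g_bound : forall i m, simplex m -> `|g i m| <= G.
Hypothesis G_ge0 : 0 <= G.
Hypothesis b_stable : forall i (u m : 'rV[R]_N) c, simplex m -> `|u| <= c -> c <= C ->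
  `|u 0 i + h * b i (u, m)| <= c + h * F.
Hypothesis CE : G + K%:R * h * F <= C.
Hypothesis a_ge0 : forall i j (z : state), simplex z.2 -> 0 <= a i j z.
Hypothesis a_bound : forall i (z : state), simplex z.2 -> `|z.1| <= C -> \sum_j a i j z <= Lam.
Hypothesis h_small : h * Lam <= 1.

Lemma value_to_go_bound p l : (forall k, simplex (path_at p k)) -> (l <= K)%N ->
  `|value_to_go p l| <= G + l%:R * h * F.
Proof.
move=> pS; have hF : 0 <= h * F by rewrite mulr_ge0 // ltW.
have bnd l' : 0 <= G + l'%:R * h * F by rewrite addr_ge0 // -mulrA mulr_ge0.
elim: l => [_|l IH lK].
  rewrite mul0r mul0r addr0; apply: rV_norm_le => // i; rewrite mxE; exact: g_bound.
apply: rV_norm_le => // i; rewrite mxE.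
have -> : G + l.+1%:R * h * F = G + l%:R * h * F + h * F by ring.
apply: b_stable => //; first exact: IH (ltnW lK).
apply: le_trans CE; rewrite lerD2l -!mulrA ler_wpM2r // ler_nat; exact: ltnW.
Qed.

Lemma value_to_go_le p l : (forall k, simplex (path_at p k)) -> (l <= K)%N ->
  `|value_to_go p l| <= C.
Proof.
move=> pS lK; apply: le_trans (value_to_go_bound pS lK) _; apply: le_trans CE.
by rewrite lerD2l -!mulrA ler_wpM2r ?mulr_ge0 ?(ltW h_gt0) // ler_nat.
Qed.

(** When [h * Lam <= 1] the step is the product by a stochastic matrix. *)
Lemma mass_step_simplex z w : simplex z.2 -> `|z.1| <= C -> simplex w ->
  simplex (mass_step z w).
Proof.
move=> zS zC [w0 w1]; split => [i|].
  rewrite mxE.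
  have -> : w 0 i + h * (\sum_j a j i z * w 0 j - (\sum_j a i j z) * w 0 i) =
    (1 - h * \sum_j a i j z) * w 0 i + h * \sum_j a j i z * w 0 j by ring.
  rewrite addr_ge0 //.
    rewrite mulr_ge0 ?w0 // subr_ge0; apply: le_trans h_small.
    by rewrite ler_wpM2l ?a_bound // ltW.
  rewrite mulr_ge0 ?(ltW h_gt0) //; apply: sumr_ge0 => j _.
  by rewrite mulr_ge0 ?w0 // a_ge0.
under eq_bigr do rewrite mxE.
rewrite big_split /= w1 -mulr_sumr sumrB exchange_big /=.
under [X in _ - X]eq_bigr do rewrite mulr_suml.
by rewrite subrr mulr0 addr0.
Qed.

(** A fixed point of the map that sends a sequence of distributions to its
    response. The backward equation evaluates [b] at the right end of each step,
    the forward equation evaluates the drift at the left end. *)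
Lemma discrete_equilibrium : exists u m : nat -> 'rV[R]_N,
  [/\ forall k, (k <= K)%N -> simplex (m k) /\ `|u k| <= C,
      (forall i, u K 0 i = g i (m K)) /\ m 0%N = c0,
      forall i k, (k < K)%N -> u k.+1 0 i - u k 0 i = h * - b i (u k.+1, m k.+1)
    & forall i k, (k < K)%N -> m k.+1 0 i - m k 0 i = h * drift i (u k, m k)].
Proof.
pose Phi (p : 'M[R]_(K.+1, N)) (k : 'I_K.+1) := mass_response p k.
have [|p k pS|p hp] := brouwer_simplices (Phi := Phi) c0S.
- by move=> k; exact: mass_response_continuous.
- have pS' l : simplex (path_at p l) by exact: pS.
  rewrite /Phi; elim: (k : nat) => [|l IH] //=.
  by apply: mass_step_simplex => //=; apply: value_to_go_le => //; exact: leq_subr.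
have pS k : simplex (path_at p k) by have [] := hp (inord k).
have fix_p k : (k <= K)%N -> mass_response p k = path_at p k.
  by move=> kK; have [_] := hp (inord k); rewrite /Phi inordK.
exists (fun k => value_to_go p (K - k)), (path_at p); split.
- move=> k kK; split => //; apply: value_to_go_le => //; exact: leq_subr.
- by split => [i|]; [rewrite subnn mxE|rewrite -fix_p].
- move=> i k kK; have -> : (K - k = (K - k.+1).+1)%N by rewrite subnSK.
  rewrite /= mxE subKn //; by ring.
- move=> i k kK; rewrite -!fix_p ?(ltnW kK) //= mxE fix_p ?(ltnW kK) // /drift /=.
  by ring.
Qed.
End Discrete.
End Scheme.

(** * Limits of Euler schemes along an ultrafilter *)

Section Euler.
Variables (R : realType) (V : normedModType R).

Section OneGrid.
(** [y] is a scalar component of the scheme. Its velocity may be evaluated at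
    either end of the step, so that forward and backward schemes are covered. *)
Variables (h M : R) (K : nat) (z : nat -> V) (y : nat -> R) (W : V -> R).
Hypothesis h_gt0 : 0 < h.
Hypothesis z_lip : forall k, (k < K)%N -> `|z k.+1 - z k| <= h * M.
Hypothesis y_step : forall k, (k < K)%N -> exists l,
  (k <= l <= k.+1)%N /\ y k.+1 - y k = h * W (z l).

Lemma euler_lipschitz j k : (j <= K)%N -> (k <= K)%N ->
  `|z j - z k| <= `|j%:R - k%:R| * h * M.
Proof.
wlog kj : j k / (k <= j)%N.
  move=> H jK kK; have [kj|/ltnW jk] := leqP k j; first exact: H.
  by rewrite distrC [`|j%:R - _|]distrC; exact: H.
move=> jK _; rewrite -natrB // ger0_norm ?ler0n //.
elim: j kj jK => [|j IH] kj jK.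
  by move: kj; rewrite leqn0 => /eqP->; rewrite !subrr normr0 !mul0r.
move: kj; rewrite leq_eqVlt => /orP[/eqP->|kj]; first by rewrite subrr subnn normr0 !mul0r.
rewrite -(subrKA (z j)) subSn //; apply: le_trans (ler_normD _ _) _.
have -> : (j - k).+1%:R * h * M = h * M + (j - k)%:R * h * M by rewrite -natr1; ring.
by apply: lerD; [exact: z_lip|apply: IH => //; exact: ltnW].
Qed.

(** The increment telescopes, in either direction of time, into velocities taken
    between the two indices only. *)
Lemma euler_increment w eps j k : (j <= K)%N -> (k <= K)%N ->
  (forall l, (minn j k <= l <= maxn j k)%N -> `|W (z l) - w| <= eps) ->
  `|y j - y k - (j%:R - k%:R) * h * w| <= `|j%:R - k%:R| * h * eps.
Proof.
wlog kj : j k / (k <= j)%N.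
  move=> H jK kK near; have [kj|/ltnW jk] := leqP k j; first exact: H.
  rewrite -normrN [`|j%:R - _|]distrC.
  have -> : - (y j - y k - (j%:R - k%:R) * h * w) = y k - y j - (k%:R - j%:R) * h * w by ring.
  by apply: H => // l; rewrite minnC maxnC; exact: near.
rewrite (minn_idPr kj) (maxn_idPl kj) => jK _.
rewrite -natrB // [`|(j - k)%:R|]ger0_norm ?ler0n //.
elim: j kj jK => [|j IH] kj jK near.
  by move: kj; rewrite leqn0 => /eqP->; rewrite !subrr !mul0r subrr normr0.
move: kj near; rewrite leq_eqVlt => /orP[/eqP->|kj] near.
  by rewrite subrr subnn !mul0r subrr normr0.
rewrite subSn //.
have [l [/andP[l1 l2] yl]] := y_step jK.
have -> : y j.+1 - y k - (j - k).+1%:R * h * w =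
    h * (W (z l) - w) + (y j - y k - (j - k)%:R * h * w).
  by rewrite -natr1 mulrBr -yl; ring.
have -> : (j - k).+1%:R * h * eps = h * eps + (j - k)%:R * h * eps by rewrite -natr1; ring.
apply: le_trans (ler_normD _ _) _; apply: lerD.
  rewrite normrM gtr0_norm // ler_wpM2l ?(ltW h_gt0) // near //.
  by rewrite l2 andbT; apply: leq_trans l1.
apply: IH => //; first exact: ltnW.
by move=> i /andP[i1 i2]; apply: near; rewrite i1 leqW.
Qed.
End OneGrid.

Section Limit.
Variables (T M : R) (K : nat -> nat) (z : nat -> nat -> V) (Z : R -> V).
Variable U : set_system nat.
Context {UF : ProperFilter U}.
Hypothesis T_gt0 : 0 < T.
Hypothesis K_gt0 : forall n, (0 < K n)%N.
Let h n : R := T / (K n)%:R.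
Hypothesis h0 : h n @[n --> U] --> (0 : R).
Hypothesis M_ge0 : 0 <= M.
Hypothesis z_lip : forall n k, (k < K n)%N -> `|z n k.+1 - z n k| <= h n * M.

(** The minimum keeps the index in range for [t > T]. *)
Definition grid_index n (t : R) : nat := minn (Num.truncn (t / (T / (K n)%:R))) (K n).

Hypothesis zZ : forall t, z n (grid_index n t) @[n --> U] --> Z t.

Let h_gt0 n : 0 < h n. Proof. by rewrite divr_gt0 ?ltr0n. Qed.

Lemma grid_index_le n t : (grid_index n t <= K n)%N.
Proof. exact: geq_minr. Qed.

Lemma grid_index0 n : grid_index n 0 = 0%N.
Proof. by rewrite /grid_index mul0r truncn0 min0n. Qed.

Lemma grid_indexT n : grid_index n T = K n.
Proof.
rewrite /grid_index invfM invrK mulrA divff ?gt_eqF // mul1r.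
by rewrite natrK minnn.
Qed.

Lemma grid_index_near n t : t \in `[0, T] ->
  (grid_index n t)%:R * h n <= t < (grid_index n t)%:R * h n + h n.
Proof.
rewrite in_itv /= => /andP[t0 tT].
have th0 : 0 <= t / h n by rewrite divr_ge0 // ltW.
have /andP[l1 l2] := truncn_itv th0.
have -> : grid_index n t = Num.truncn (t / h n).
  apply/minn_idPl; rewrite -(ler_nat R); apply: le_trans l1 _.
  by rewrite ler_pdivrMr // /h mulrCA divff ?mulr1 // pnatr_eq0 -lt0n.
rewrite -ler_pdivlMr // l1 /= -[X in _ + X]mul1r -mulrDl -ltr_pdivrMr //.
by rewrite natr1.
Qed.

Lemma grid_index_dist n s t : s \in `[0, T] -> t \in `[0, T] ->
  `|((grid_index n s)%:R - (grid_index n t)%:R) * h n - (s - t)| <= h n.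
Proof.
move=> /(grid_index_near n)/andP[s1 s2] /(grid_index_near n)/andP[t1 t2].
by rewrite ler_norml mulrBl; apply/andP; split; lra.
Qed.

Lemma grid_index_dist_le n s t : s \in `[0, T] -> t \in `[0, T] ->
  `|(grid_index n s)%:R - (grid_index n t)%:R| * h n <= `|s - t| + h n.
Proof.
move=> sT tT; rewrite -[h n in leLHS]gtr0_norm // -normrM [leRHS]addrC.
by rewrite -lerBlDr; apply: le_trans (lerB_dist _ _) _; exact: grid_index_dist.
Qed.

(** The scheme is [M]-Lipschitz up to an error of one time step. *)
Lemma limit_lipschitz s t : s \in `[0, T] -> t \in `[0, T] ->
  `|Z s - Z t| <= `|s - t| * M.
Proof.
move=> sT tT.
have c1 : `|z n (grid_index n s) - z n (grid_index n t)| @[n --> U] --> `|Z s - Z t|.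
  by apply: cvg_norm; exact: cvgB.
have c2 : (`|s - t| + h n) * M @[n --> U] --> (`|s - t| + 0) * M.
  apply: (@cvgM R _ U _ _ (fun=> M)); last exact: cvg_cst.
  by apply: (@cvgD R R^o _ U _ (fun=> `|s - t|) h) => //; exact: cvg_cst.
rewrite -[`|s - t|]addr0; apply: (ler_cvg_to c1 c2); apply: filterE => n.
apply: le_trans (euler_lipschitz (@z_lip n) (grid_index_le n s) (grid_index_le n t)) _.
by rewrite ler_wpM2r // grid_index_dist_le.
Qed.

Variables (y : nat -> nat -> R) (Y : R -> R) (W : V -> R).
Hypothesis W_cont : continuous W.
Hypothesis y_step : forall n k, (k < K n)%N -> exists l,
  (k <= l <= k.+1)%N /\ y n k.+1 - y n k = h n * W (z n l).
Hypothesis yY : forall t, y n (grid_index n t) @[n --> U] --> Y t.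

(** For [s] near [t] and large [n], all the states of the scheme between the times
    [t] and [s] are close to [Z t], so that the mean velocity over this interval
    is close to [W (Z t)]. *)
Lemma limit_increment t eps : t \in `[0, T] -> 0 < eps ->
  exists2 d, 0 < d & forall s, s \in `[0, T] -> `|s - t| < d ->
    `|Y s - Y t - (s - t) * W (Z t)| <= `|s - t| * eps.
Proof.
move=> tT eps0; set w := W (Z t).
have [d0 d00 Wd] : exists2 d0, 0 < d0 & forall v, `|Z t - v| < d0 -> `|W v - w| <= eps.
  have := @W_cont (Z t); move/cvgrPdist_le => /(_ _ eps0) /nbhs_normP[d0 /= d00 H].
  by exists d0 => // v /H; rewrite distrC.
have M1 : 0 < 4 * (M + 1) by rewrite mulr_gt0 // ltr_wpDl.
pose d := d0 / (4 * (M + 1)).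
have d_gt0 : 0 < d by rewrite divr_gt0.
exists d => // s sT std.
have dM : (d + d) * M <= d0 / 2.
  have -> : d0 = 4 * (M + 1) * d by rewrite /d mulrC divfK // gt_eqF.
  have := mulr_ge0 (ltW d_gt0) M_ge0; nra.
have c1 : `|y n (grid_index n s) - y n (grid_index n t) - (s - t) * w| @[n --> U] -->
    `|Y s - Y t - (s - t) * w|.
  apply: cvg_norm; apply: (@cvgB R R^o); last exact: cvg_cst.
  exact: (@cvgB R R^o).
have c2 : (`|s - t| + h n) * eps + h n * `|w| @[n --> U] --> (`|s - t| + 0) * eps + 0 * `|w|.
  apply: (@cvgD R R^o).
    apply: (@cvgM R _ U _ _ (fun=> eps)); last exact: cvg_cst.
    by apply: (@cvgD R R^o _ U _ (fun=> `|s - t|) h) => //; exact: cvg_cst.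
  by apply: (@cvgM R _ U _ h (fun=> `|w|)) => //; exact: cvg_cst.
have -> : `|s - t| * eps = (`|s - t| + 0) * eps + 0 * `|w| by ring.
apply: (ler_cvg_to c1 c2).
have e1 : \forall n \near U, `|Z t - z n (grid_index n t)| < d0 / 2.
  by have := @zZ t; move/cvgrPdist_lt; apply; rewrite divr_gt0.
have e2 : \forall n \near U, h n < d.
  by have := h0; move/cvgrPdist_lt => /(_ _ d_gt0); apply: filterS => n; rewrite sub0r normrN gtr0_norm.
apply: filterS2 e1 e2 => n zn hn.
set a := grid_index n s; set b := grid_index n t.
have aK : (a <= K n)%N := grid_index_le n s.
have bK : (b <= K n)%N := grid_index_le n t.
have ab : `|a%:R - b%:R| * h n <= `|s - t| + h n by exact: grid_index_dist_le.
have incr : `|y n a - y n b - (a%:R - b%:R) * h n * w| <= `|a%:R - b%:R| * h n * eps.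
  apply: (euler_increment (K := K n) (z := z n) (W := W)) => // [k|l /andP[l1 l2]].
    exact: y_step.
  apply: Wd; rewrite -(subrKA (z n b)).
  apply: le_lt_trans (ler_normD _ _) _; rewrite [ltRHS]splitr; apply: ltr_leD => //.
  have lK : (l <= K n)%N by apply: leq_trans l2 _; rewrite geq_max aK.
  apply: le_trans (euler_lipschitz (@z_lip n) bK lK) _.
  apply: le_trans dM; rewrite ler_wpM2r //.
  apply: (@le_trans _ _ (`|a%:R - b%:R| * h n)); last by apply: le_trans ab _; rewrite lerD // ltW.
  rewrite ler_wpM2r ?(ltW (h_gt0 n)) //.
  move: l1 l2; have [ba|/ltnW ba] := leqP b a.
    move=> l1 l2; rewrite distrC -!natrB // ?ger0_norm ?ler0n // ler_nat; exact: leq_sub2r.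
  move=> l1 l2; rewrite [leRHS]distrC -!natrB // ?ger0_norm ?ler0n // ler_nat; exact: leq_sub2l.
have -> : y n a - y n b - (s - t) * w = (y n a - y n b - (a%:R - b%:R) * h n * w) +
    ((a%:R - b%:R) * h n - (s - t)) * w by ring.
apply: le_trans (ler_normD _ _) _; apply: lerD.
  by apply: le_trans incr _; rewrite ler_wpM2r // ltW.
by rewrite normrM ler_wpM2r // grid_index_dist.
Qed.

End Limit.
End Euler.

Section RelDeriv.
Variables (R : realType) (T : R).
Hypothesis T_gt0 : 0 < T.

(** Every point of the segment is an accumulation point of the segment, so that
    relative derivatives are determined by the limits of difference quotients. *)
Lemma within_segment_proper (t : R) : t \in `[0, T] ->
  ProperFilter (within [set` `[0, T]] t^').
Proof.
rewrite in_itv /= => /andP[t0 tT].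
apply: Build_ProperFilter_ex => A /nbhs_normP[d /= d0 H].
have [tT2|tT2] := ltP t (T / 2).
  pose e := Num.min (d / 2) (T / 2).
  have e0 : 0 < e by rewrite lt_min !divr_gt0.
  have e1 : e <= d / 2 by rewrite ge_min lexx.
  have e2 : e <= T / 2 by rewrite ge_min lexx orbT.
  exists (t + e); apply: H => /=.
  - by rewrite opprD addrA subrr sub0r normrN gtr0_norm //; lra.
  - by rewrite gt_eqF // ltrDl.
  - by rewrite in_itv /=; lra.
pose e := Num.min (d / 2) (T / 2).
have e0 : 0 < e by rewrite lt_min !divr_gt0.
have e1 : e <= d / 2 by rewrite ge_min lexx.
have e2 : e <= T / 2 by rewrite ge_min lexx orbT.
exists (t - e); apply: H => /=.
- by rewrite opprD addrA subrr sub0r opprK gtr0_norm //; lra.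
- by rewrite lt_eqF // gtrBl.
- by rewrite in_itv /=; lra.
Qed.

Lemma derive_on_increment (F : R -> R) (t w : R) : t \in `[0, T] ->
  (forall eps, 0 < eps -> exists2 d, 0 < d & forall s, s \in `[0, T] -> `|s - t| < d ->
    `|F s - F t - (s - t) * w| <= `|s - t| * eps) ->
  derivable_on [set` `[0, T]] F t /\ derive_on [set` `[0, T]] F t = w.
Proof.
move=> tT H; have PF := within_segment_proper tT.
have c : diff_quotient F t @ within [set` `[0, T]] t^' --> w.
  apply/cvgrPdist_le => eps eps0; have [d d0 Hd] := H _ eps0.
  apply/nbhs_normP; exists d => //= s /= ts st sT.
  have st0 : 0 < `|s - t| by rewrite normr_gt0 subr_eq0.
  rewrite -(ler_pM2l st0) -normrM; apply: le_trans (Hd s sT _); last by rewrite distrC.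
  rewrite /diff_quotient mulrBr mulrCA divff ?subr_eq0 // mulr1 distrC; exact: lexx.
by split; [apply/cvg_ex; exists w|exact/cvg_lim].
Qed.

Lemma C1_on_increment (F w : R -> R) : {within [set` `[0, T]], continuous w} ->
  (forall t eps, t \in `[0, T] -> 0 < eps -> exists2 d, 0 < d &
    forall s, s \in `[0, T] -> `|s - t| < d ->
      `|F s - F t - (s - t) * w t| <= `|s - t| * eps) ->
  C1_on [set` `[0, T]] F /\
  forall t, t \in `[0, T] -> derive_on [set` `[0, T]] F t = w t.
Proof.
move=> wc H.
have HH t : t \in `[0, T] -> _ := fun tT => derive_on_increment tT (fun eps => H t eps tT).
have dE t : t \in `[0, T] -> derive_on [set` `[0, T]] F t = w t by move=> /HH[].
split => //; split => [t /HH[]//|].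
apply: (@subspace_eq_continuous _ [set` `[0, T]] _ w) => // t.
by rewrite inE => /dE /esym.
Qed.

Lemma lipschitz_within_continuous (V : normedModType R) (Z : R -> V) (M : R) : 0 <= M ->
  (forall s t, s \in `[0, T] -> t \in `[0, T] -> `|Z s - Z t| <= `|s - t| * M) ->
  {within [set` `[0, T]], continuous Z}.
Proof.
move=> M0 H; apply/subspace_continuousP => t /= tT.
apply/cvgrPdist_le => eps eps0; have M1 : 0 < M + 1 by rewrite ltr_wpDl.
apply/nbhs_normP; exists (eps / (M + 1)) => /=; first by rewrite divr_gt0.
move=> s /= ts sT; apply: le_trans (H t s tT sT) _.
rewrite -[eps](divfK (lt0r_neq0 M1)); apply: ler_pM => //; first exact: ltW.
by rewrite lerDl.
Qed.
End RelDeriv.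

(** * Forward-backward systems with stable backward steps *)

Lemma compact_bound (R : realType) (X : topologicalType) (A : set X) (f : X -> R) :
  compact A -> continuous f -> exists2 M, 0 <= M & forall x, A x -> `|f x| <= M.
Proof.
move=> cA fc; have [->|/set0P A0] := eqVneq A set0; first by exists 0.
have [c _ Hc] := @compact_EVT_max X R (fun x => `|f x|) A A0 cA
  (continuous_subspaceT (fun x => cvg_norm (@fc x))).
exists `|f c| => // x Ax; apply: Hc; exact: mem_set.
Qed.

Lemma compact_bound_fin (R : realType) (X : topologicalType) (A : set X) (I : finType)
  (f : I -> X -> R) : compact A -> (forall i, continuous (f i)) ->
  exists2 M, 0 <= M & forall i x, A x -> `|f i x| <= M.
Proof.
move=> cA fc.
have /choice[M hM] : forall i, exists M, 0 <= M /\ forall x, A x -> `|f i x| <= M.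
  by move=> i; have [M M0 h] := compact_bound cA (@fc i); exists M.
exists (\sum_i M i) => [|i x Ax]; first by apply: sumr_ge0 => i _; have [] := hM i.
apply: le_trans ((hM i).2 x Ax) _; rewrite (bigD1 i) //= lerDl.
by apply: sumr_ge0 => j _; have [] := hM j.
Qed.

Lemma compact_box (R : realType) n (C : R) :
  compact [set x : 'rV[R]_n | forall i, `[- C, C]%classic (x 0 i)].
Proof.
by apply: (@rV_compact R n (fun=> `[- C, C]%classic)) => _; exact: segment_compact.
Qed.

(** Jump rates [a] and a backward equation with right-hand side [b] satisfying
    a stability estimate: a small step backward increases the sup norm of the
    values by at most [h * F], as long as it stays below [G + T * F], which is
    the bound that this estimate propagates from the final time. *)
Section ForwardBackward.
Variables (R : realType) (N : nat) (T : R) (c0 : 'rV[R]_N).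
Notation state := ('rV[R]_N * 'rV[R]_N)%type.
Variables (b : 'I_N -> state -> R) (a : 'I_N -> 'I_N -> state -> R).
Variable (g : 'I_N -> 'rV[R]_N -> R).
Variables (F G h0 : R).
Hypotheses (T_gt0 : 0 < T) (c0S : simplex c0).
Hypotheses (bc : forall i, continuous (b i)) (ac : forall i j, continuous (a i j)).
Hypothesis gc : forall i, continuous (g i).
Hypotheses (F_ge0 : 0 <= F) (G_ge0 : 0 <= G) (h0_gt0 : 0 < h0).
Hypothesis g_bound : forall i m, simplex m -> `|g i m| <= G.
Hypothesis a_ge0 : forall i j (z : state), simplex z.2 -> 0 <= a i j z.
Hypothesis b_stable : forall h, 0 < h -> h <= h0 ->
  forall i (u m : 'rV[R]_N) c, simplex m -> `|u| <= c -> c <= G + T * F ->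
  `|u 0 i + h * b i (u, m)| <= c + h * F.

Lemma drift_continuous i : continuous (drift a i).
Proof.
have cc j : continuous (fun z : state => z.2 0 j).
  by apply: continuous_coord => z; exact: cvg_snd.
apply: continuous_fB; last first.
  by apply: continuous_fM => //; apply: (@sum_continuous _ _ _ _ (fun j z => a i j z)) => j; exact: ac.
apply: (@sum_continuous _ _ _ _ (fun j z => a j i z * z.2 0 j)) => j.
by apply: continuous_fM => //; exact: ac.
Qed.

(** Limit of discrete equilibria along an ultrafilter. *)
Theorem forward_backward_system : exists u m : R -> 'rV[R]_N,
  [/\ forall t, t \in `[0, T] -> simplex (m t),
      forall i, u T 0 i = g i (m T),
      m 0 = c0,
      forall i, C1_on [set` `[0, T]] (fun s => u s 0 i) /\
        forall t, t \in `[0, T] ->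
          derive_on [set` `[0, T]] (fun s => u s 0 i) t = - b i (u t, m t)
    & forall i, C1_on [set` `[0, T]] (fun s => m s 0 i) /\
        forall t, t \in `[0, T] ->
          derive_on [set` `[0, T]] (fun s => m s 0 i) t = drift a i (u t, m t)].
Proof.
pose C := G + T * F.
have C0 : 0 <= C by rewrite addr_ge0 // mulr_ge0 // ltW.
pose box := [set x : 'rV[R]_N | forall i, `[- C, C]%classic (x 0 i)].
have boxP x : box x <-> `|x| <= C.
  split=> [h|h i /=]; first by apply: rV_norm_le => // i; have := h i; rewrite /= in_itv /= ler_norml.
  by rewrite in_itv /= -ler_norml; apply: le_trans h; exact: rV_coord_le.
pose KS : set state := box `*` @simplex R N.
have KSc : compact KS by apply: compact_setX; [exact: compact_box|exact: compact_simplex].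
have [Lam Lam0 hLam] := compact_bound_fin (f := fun i z => \sum_j a i j z) KSc
  (fun i => @sum_continuous _ _ _ _ (fun j z => a i j z) (fun j => @ac i j)).
have [Mb Mb0 hMb] := compact_bound_fin KSc bc.
have [Md Md0 hMd] := compact_bound_fin KSc drift_continuous.
(* Time steps below [hm] satisfy both the stability condition and
   [h * Lam <= 1]. *)
pose hm := Num.min h0 (Lam + 1)^-1.
have L1 : 0 < Lam + 1 by rewrite ltr_wpDl.
have hm0 : 0 < hm by rewrite lt_min h0_gt0 invr_gt0.
pose n0 := Num.truncn (T / hm).
pose K n := (n0 + n).+1.
pose h n : R := T / (K n)%:R.
have K0 n : 0 < (K n)%:R :> R by rewrite ltr0n.
have h_gt0 n : 0 < h n by rewrite divr_gt0.
have h_le n : h n <= hm.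
  rewrite /h ler_pdivrMr // mulrC -ler_pdivrMr //; apply: ltW.
  have /andP[_ l] := truncn_itv (ltW (divr_gt0 T_gt0 hm0)).
  by apply: lt_le_trans l _; rewrite ler_nat ltnS leq_addr.
have h_h0 n : h n <= h0 by apply: le_trans (h_le n) _; rewrite ge_min lexx.
have h_Lam n : h n * Lam <= 1.
  apply: (@le_trans _ _ ((Lam + 1)^-1 * (Lam + 1))); last by rewrite mulVf // gt_eqF.
  apply: ler_pM => //; first exact: ltW.
    by apply: le_trans (h_le n) _; rewrite ge_min lexx orbT.
  by rewrite lerDl.
have /choice[us /choice[ms sol]] : forall n, exists us ms : nat -> 'rV[R]_N,
  [/\ forall k, (k <= K n)%N -> simplex (ms k) /\ `|us k| <= C,
      (forall i, us (K n) 0 i = g i (ms (K n))) /\ ms 0%N = c0,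
      forall i k, (k < K n)%N -> us k.+1 0 i - us k 0 i = h n * - b i (us k.+1, ms k.+1)
    & forall i k, (k < K n)%N -> ms k.+1 0 i - ms k 0 i = h n * drift a i (us k, ms k)].
  move=> n; apply: (discrete_equilibrium bc ac gc (C := C) (G := G) (F := F) (Lam := Lam)) => //.
  - by move=> i u m c mS uc cC; apply: b_stable.
  - by rewrite /C /h [_ * (T / _)]mulrC divfK // gt_eqF.
  - move=> i z zS zC; apply: le_trans (ler_norm _) _; apply: hLam; split => //.
    exact/boxP.
pose z n k : state := (us n k, ms n k).
have zKS n k : (k <= K n)%N -> KS (z n k).
  by move=> kK; have [+ _ _ _] := sol n; move=> /(_ k kK)[mS uC]; split => //; exact/boxP.
have [U [UU Uoo]] := ultra_nat.
have hU : h n @[n --> U] --> (0 : R).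
  apply/cvgrPdist_le => e e0; apply: Uoo.
  have /cvgrPdist_le/(_ _ e0) := cvg_natr_inv T; apply: filterS => n.
  rewrite !sub0r !normrN !gtr0_norm ?divr_gt0 //; apply: le_trans.
  by rewrite ler_pM2l // lef_pV2 ?posrE ?ltr0n // ler_nat ltnS leq_addl.
have /choice[Z hZ] : forall t, exists l, KS l /\ z n (grid_index T K n t) @[n --> U] --> l.
  move=> t; apply: (ultra_compact (V := state) UU KSc); apply: filterE => n; apply: zKS; exact: grid_index_le.
have zZ t : z n (grid_index T K n t) @[n --> U] --> Z t by have [] := hZ t.
have zZ1 t : us n (grid_index T K n t) @[n --> U] --> (Z t).1.
  exact: cvg_comp (zZ t) (@cvg_fst _ _ _ _ _).
have zZ2 t : ms n (grid_index T K n t) @[n --> U] --> (Z t).2.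
  exact: cvg_comp (zZ t) (@cvg_snd _ _ _ _ _).
have ustep n i k : (k < K n)%N -> us n k.+1 0 i - us n k 0 i = h n * - b i (z n k.+1).
  by have [_ _ + _] := sol n; exact.
have mstep n i k : (k < K n)%N -> ms n k.+1 0 i - ms n k 0 i = h n * drift a i (z n k).
  by have [_ _ _ +] := sol n; exact.
pose M := Num.max Mb Md.
have M0 : 0 <= M by rewrite le_max Mb0.
have z_lip n k : (k < K n)%N -> `|z n k.+1 - z n k| <= h n * M.
  move=> kK; rewrite prod_normE /= ge_max.
  have hM0 : 0 <= h n * M by rewrite mulr_ge0 // ltW.
  apply/andP; split; apply: rV_norm_le => // i.
    rewrite !mxE ustep // normrM normrN gtr0_norm // ler_pM2l // le_max hMb //; exact: zKS.
  by rewrite !mxE mstep // normrM gtr0_norm // ler_pM2l // le_max hMd ?orbT //; exact/zKS/ltnW.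
have Zc : {within [set` `[0, T]], continuous Z}.
  apply: (lipschitz_within_continuous M0) => s t sT tT.
  exact: (limit_lipschitz T_gt0 _ hU M0 z_lip zZ).
have WZc (W : state -> R) : continuous W -> {within [set` `[0, T]], continuous (W \o Z)}.
  by move=> Wc; exact: (@continuous_fcomp (subspace [set` `[0, T]]) _ _ Z W Zc Wc).
have K_gt0 n : (0 < K n)%N by [].
have solves (y : nat -> nat -> R) (Y W : _ -> R) : continuous W ->
    (forall n k, (k < K n)%N -> exists l, (k <= l <= k.+1)%N /\
       y n k.+1 - y n k = h n * W (z n l)) ->
    (forall t, y n (grid_index T K n t) @[n --> U] --> Y t) ->
    C1_on [set` `[0, T]] Y /\
    forall t, t \in `[0, T] -> derive_on [set` `[0, T]] Y t = W ((Z t).1, (Z t).2).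
  move=> Wc ystep yY.
  have [|C1Y dY] := C1_on_increment T_gt0 (WZc W Wc) (F := Y).
    move=> t eps tT eps0.
    exact: (limit_increment T_gt0 K_gt0 hU M0 z_lip zZ Wc ystep yY tT eps0).
  by split => // t /dY ->; rewrite /=; case: (Z t).
have Zboundary : (forall i, (Z T).1 0 i = g i (Z T).2) /\ (Z 0).2 = c0.
  split=> [i|].
    have c1 : g i (ms n (grid_index T K n T)) @[n --> U] --> (Z T).1 0 i.
      rewrite (_ : (fun _ => _) = (fun n => us n (grid_index T K n T) 0 i)).
        exact: (@rV_cvg_coord _ _ U _ _ _ i _ (zZ1 T)).
      apply/funext => n; rewrite grid_indexT //.
      by have [_ [-> _] _ _] := sol n.
    have c2 : g i (ms n (grid_index T K n T)) @[n --> U] --> g i (Z T).2.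
      exact: cvg_comp (zZ2 T) (@gc i (Z T).2).
    exact: cvg_unique c1 c2.
  have c1 : ms n (grid_index T K n 0) @[n --> U] --> c0.
    apply: cvg_near_cst; apply: filterE => n; rewrite grid_index0.
    by have [_ [_ ->] _ _] := sol n.
  exact: cvg_unique (zZ2 0) c1.
exists (fun t => (Z t).1), (fun t => (Z t).2); split.
- by move=> t _; have [[]] := hZ t.
- by case: Zboundary.
- by case: Zboundary.
- move=> i; apply: (solves (fun n k => us n k 0 i) _ (fun v => - b i v)).
  + by move=> v; apply: cvgN; exact: bc.
  + by move=> n k kK; exists k.+1; rewrite leqnn leqnSn ustep.
  + by move=> t; exact: (@rV_cvg_coord _ _ U _ _ _ i _ (zZ1 t)).
- move=> i; apply: (solves (fun n k => ms n k 0 i) _ (drift a i)).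
  + exact: drift_continuous.
  + by move=> n k kK; exists k; rewrite leqnn leqnSn mstep.
  + by move=> t; exact: (@rV_cvg_coord _ _ U _ _ _ i _ (zZ2 t)).
Qed.
End ForwardBackward.

(** * Legendre transform of a superlinear strictly convex cost *)

(** The parameter [mu] ranges over an arbitrary topological space, and coercivity
    is uniform in it: this makes the maximisers locally bounded. *)
Section Legendre.
Variables (R : realType) (d : nat) (X : topologicalType).
Variable L : 'rV[R]_d -> X -> R.
Hypothesis L_cont : continuous (fun z : 'rV[R]_d * X => L z.1 z.2).
Hypothesis L_conv : forall mu, strictly_convex_on (@orthant R d) (L ^~ mu).
Hypothesis L_coercive : forall B, exists r, forall l, orthant l -> r < `|l| ->
  forall mu, B * `|l| <= L l mu.
Variable C0 : R.
Hypothesis L_zero : forall mu, L 0 mu <= C0.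

Definition payoff (l p : 'rV[R]_d) (mu : X) : R := dot l p - L l mu.

Lemma orthant0 : @orthant R d 0.
Proof. by move=> k; rewrite mxE. Qed.

Lemma dotDr (x y z : 'rV[R]_d) : dot x (y + z) = dot x y + dot x z.
Proof. by rewrite /dot -big_split; apply: eq_bigr => k _; rewrite mxE mulrDr. Qed.

Lemma dotZr c (x y : 'rV[R]_d) : dot x (c *: y) = c * dot x y.
Proof. by rewrite /dot mulr_sumr; apply: eq_bigr => k _; rewrite mxE mulrCA. Qed.

Lemma dotC (x y : 'rV[R]_d) : dot x y = dot y x.
Proof. by apply: eq_bigr => k _; rewrite mulrC. Qed.

Lemma dot0l (x : 'rV[R]_d) : dot 0 x = 0.
Proof. by rewrite /dot big1 // => k _; rewrite mxE mul0r. Qed.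

Lemma dot_le (x y : 'rV[R]_d) : dot x y <= d%:R * `|x| * `|y|.
Proof.
rewrite /dot -mulrA mulr_natl -[X in _ *+ X]card_ord -sumr_const.
apply: ler_sum => k _; apply: le_trans (ler_norm _) _; rewrite normrM.
by apply: ler_pM => //; exact: rV_coord_le.
Qed.

Lemma dot_continuous (Y : topologicalType) (f k : Y -> 'rV[R]_d) :
  continuous f -> continuous k -> continuous (fun y => dot (f y) (k y)).
Proof.
move=> fc kc; apply: (@sum_continuous _ _ _ _ (fun i y => f y 0 i * k y 0 i)) => i.
by apply: continuous_fM; exact: continuous_coord.
Qed.

Lemma payoff_continuous (Y : topologicalType) (f k : Y -> 'rV[R]_d) (m : Y -> X) :
  continuous f -> continuous k -> continuous m ->
  continuous (fun y => payoff (f y) (k y) (m y)).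
Proof.
move=> fc kc mc; apply: continuous_fB; first exact: dot_continuous.
exact: (continuous_fcomp (continuous_fpair fc mc) L_cont).
Qed.

(** Beyond the radius where [L] dominates [(d * P + 1) * |l|], the payoff is at most
    [- |l|], and so falls below the payoff of [0] once [|l|] exceeds [C0]. *)
Lemma payoff_bounded P : exists2 Lam, 0 <= Lam & forall l p mu, orthant l -> `|p| <= P ->
  payoff 0 p mu <= payoff l p mu -> `|l| <= Lam.
Proof.
have [r hr] := L_coercive (d%:R * P + 1).
exists (Num.max (Num.max r C0) 0) => [|l p mu l0 pP]; first by rewrite le_max lexx orbT.
move=> le; rewrite leNgt; apply/negP; rewrite !gt_max -andbA => /and3P[rl cl l_gt0].
move: le; apply/negP; rewrite -ltNge /payoff dot0l sub0r.
have := hr l l0 rl mu; have := dot_le l p; have := L_zero mu.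
have : d%:R * `|l| * `|p| <= d%:R * `|l| * P by rewrite ler_wpM2l // mulr_ge0.
by move=> *; nra.
Qed.

Definition is_argmax (p : 'rV[R]_d) (mu : X) (l : 'rV[R]_d) :=
  orthant l /\ forall l', orthant l' -> payoff l' p mu <= payoff l p mu.

Lemma is_argmax_ex p mu : exists l, is_argmax p mu l.
Proof.
have [Lam Lam0 hL] := payoff_bounded `|p|.
pose A := [set l : 'rV[R]_d | forall i, `[0, Lam]%classic (l 0 i)].
have cA : compact A.
  by apply: (@rV_compact R d (fun=> `[0, Lam]%classic)) => _; exact: segment_compact.
have A0 : A 0 by move=> i /=; rewrite mxE in_itv /= lexx.
have pc : continuous (fun l => payoff l p mu).
  apply: (@payoff_continuous _ id (fun=> p) (fun=> mu)); first by move=> l; exact: cvg_id.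
    exact: cst_continuous.
  exact: cst_continuous.
have [l lA lmax] := compact_EVT_max (ex_intro _ _ A0) cA (continuous_subspaceT pc).
have lP : orthant l by move=> k; have := set_mem lA k; rewrite /= in_itv /= => /andP[].
exists l; split => // l' l'0.
have [le|/ltW le] := leP (payoff 0 p mu) (payoff l' p mu).
  apply: lmax; apply: mem_set => i /=; rewrite in_itv /= l'0 /=.
  apply: le_trans (ler_norm _) _; apply: le_trans (rV_coord_le _ _) _.
  exact: hL l'0 (lexx _) le.
by apply: le_trans le _; apply: lmax; exact: mem_set.
Qed.

(** The midpoint of two distinct maximisers would do strictly better. *)
Lemma is_argmax_uniq p mu l l' : is_argmax p mu l -> is_argmax p mu l' -> l = l'.
Proof.
move=> [l0 lmax] [l'0 l'max]; apply/eqP/negPn/negP => ne.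
have h1 : 0 < (2^-1 : R) < 1 by lra.
have := @L_conv mu _ _ _ l0 l'0 ne h1.
set x := _ *: l + _; have x0 : orthant x.
  by move=> k; rewrite !mxE addr_ge0 // mulr_ge0 ?l0 ?l'0 //; lra.
have := lmax x x0; have := l'max x x0; have := lmax _ l'0; have := l'max _ l0.
have -> : payoff x p mu = 2^-1 * dot l p + (1 - 2^-1) * dot l' p - L x mu.
  by rewrite /payoff [dot x p]dotC dotDr !dotZr ![dot p _]dotC.
by rewrite /payoff; lra.
Qed.

Definition argmax (p : 'rV[R]_d) (mu : X) : 'rV[R]_d := xget 0 (is_argmax p mu).

Lemma argmaxP p mu : is_argmax p mu (argmax p mu).
Proof. by have [l hl] := is_argmax_ex p mu; exact: (xgetI 0 hl). Qed.

Lemma argmax_bounded P : exists2 Lam, 0 <= Lam &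
  forall p mu, `|p| <= P -> `|argmax p mu| <= Lam.
Proof.
have [Lam Lam0 hL] := payoff_bounded P; exists Lam => // p mu pP.
by have [l0 lmax] := argmaxP p mu; apply: hL pP _ => //; apply: lmax; exact: orthant0.
Qed.

(** By local boundedness, the maximisers at nearby points converge along any
    ultrafilter; the limit is a maximiser by continuity of the payoff, and
    there is only one. *)
Lemma argmax_continuous : continuous (fun z : 'rV[R]_d * X => argmax z.1 z.2).
Proof.
move=> z0; set l0 := argmax z0.1 z0.2; move=> O nO.
have [//|nnear] := pselect (nbhs z0 ((fun z : 'rV[R]_d * X => argmax z.1 z.2) @^-1` O)).
pose B := [set z : 'rV[R]_d * X | ~ O (argmax z.1 z.2)].
have PF : ProperFilter (within B (nbhs z0)).
  apply: Build_ProperFilter_ex => A hA; apply: contrapT => nA; apply: nnear.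
  have {}hA : nbhs z0 [set z | B z -> A z] by exact: hA.
  apply: filterS hA => z hz; apply: contrapT => Bz; apply: nA; exists z; exact: hz.
have [U [UU sU]] := ultraFilterLemma PF.
have UB : U B by apply: sU; exact: withinT.
have Uz : U --> z0 by move=> A hA; apply: sU; exact: cvg_within hA.
have [Lam Lam0 hL] := argmax_bounded (`|z0.1| + 1).
have U1 : z.1 @[z --> U] --> z0.1 by exact: cvg_comp Uz (@cvg_fst _ _ _ _ _).
have [l1 [l1K Ul1]] : exists l1, [set l : 'rV[R]_d | forall i, `[0, Lam]%classic (l 0 i)] l1
    /\ argmax z.1 z.2 @[z --> U] --> l1.
  apply: (ultra_compact UU).
    by apply: (@rV_compact R d (fun=> `[0, Lam]%classic)) => _; exact: segment_compact.
  have /cvgrPdist_le/(_ _ ltr01) := U1; apply: filterS => z hz i /=.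
  have [lz _] := argmaxP z.1 z.2; rewrite in_itv /= lz /=.
  apply: le_trans (ler_norm _) _; apply: le_trans (rV_coord_le _ _) _; apply: hL.
  rewrite -[z.1](subrK z0.1) addrC; apply: le_trans (ler_normD _ _) _.
  by rewrite lerD2l distrC.
suff l1E : l1 = l0.
  by rewrite l1E in Ul1; have /filter_ex[z []] : U (B `&` [set z | O (argmax z.1 z.2)])
    by apply: filterI => //; exact: Ul1.
apply: (@is_argmax_uniq z0.1 z0.2); last exact: argmaxP.
split=> [k|l' l'0]; first by have := l1K k; rewrite /= in_itv /= => /andP[].
have U2 : z.2 @[z --> U] --> z0.2 by exact: cvg_comp Uz (@cvg_snd _ _ _ _ _).
have pay_lim (lz : 'rV[R]_d * X -> 'rV[R]_d) l : lz z @[z --> U] --> l ->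
    payoff (lz z) z.1 z.2 @[z --> U] --> payoff l z0.1 z0.2.
  move=> hl.
  have pc : continuous (fun y : 'rV[R]_d * ('rV[R]_d * X) => payoff y.1 y.2.1 y.2.2).
    apply: payoff_continuous => y; first exact: cvg_fst.
      by apply: cvg_comp; [exact: cvg_snd|exact: cvg_fst].
    by apply: cvg_comp; [exact: cvg_snd|exact: cvg_snd].
  have pr : (lz z, z) @[z --> U] --> (l, z0) by exact: cvg_pair hl (Uz : id z @[z --> U] --> z0).
  exact: cvg_comp pr (pc (l, z0)).
apply: (ler_cvg_to (pay_lim (cst l') l' (cvg_cst _)) (pay_lim _ _ Ul1)).
by apply: filterE => z; have [_] := argmaxP z.1 z.2; exact.
Qed.

Definition legendre (p : 'rV[R]_d) (mu : X) : R := payoff (argmax p mu) p mu.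

Lemma legendre_sup p mu :
  sup [set dot l p - L l mu | l in @orthant R d] = legendre p mu.
Proof.
have [l0 lmax] := argmaxP p mu.
apply/eqP; rewrite eq_le; apply/andP; split.
  apply: ge_sup; first by exists (payoff 0 p mu), 0 => //; exact: orthant0.
  by move=> _ [l hl <-]; exact: lmax.
apply: ub_le_sup; last by exists (argmax p mu).
by exists (legendre p mu) => _ [l hl <-]; exact: lmax.
Qed.

Lemma legendre_continuous : continuous (fun z : 'rV[R]_d * X => legendre z.1 z.2).
Proof.
apply: payoff_continuous; first exact: argmax_continuous.
  by move=> z; exact: cvg_fst.
by move=> z; exact: cvg_snd.
Qed.

Lemma legendre_ge p mu : - C0 <= legendre p mu.
Proof.
have [_ lmax] := argmaxP p mu; apply: le_trans (lmax 0 orthant0).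
by rewrite /payoff dot0l sub0r lerN2.
Qed.

(** If [p k] is the difference between the values at the [k]-th successor and at
    the current node, and all values are at most [c] above the current one, then
    a step of the Hamilton-Jacobi recursion cannot exceed the maximal value: it
    moves to the successors with total probability at most 1 and pays a cost. *)
Lemma legendre_step_le (h c : R) (p : 'rV[R]_d) (mu : X) : (forall l nu, orthant l -> 0 <= L l nu) ->
  0 <= h -> 0 <= c -> (forall k, p 0 k <= c) -> h * \sum_k argmax p mu 0 k <= 1 ->
  h * legendre p mu <= c.
Proof.
move=> L0 h0 c0 pc mass1; have [l0 _] := argmaxP p mu.
have le_dot : legendre p mu <= (\sum_k argmax p mu 0 k) * c.
  apply: (@le_trans _ _ (dot (argmax p mu) p)).
    by rewrite /legendre /payoff gerBl; exact: L0.
  by rewrite mulr_suml; apply: ler_sum => k _; rewrite ler_wpM2l.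
apply: le_trans (ler_wpM2l h0 le_dot) _.
by rewrite mulrA ler_piMl.
Qed.

(** The maximiser at [p] is a subgradient at [p]. *)
Lemma legendre_tangent p q mu : dot (argmax p mu) (q - p) <= legendre q mu - legendre p mu.
Proof.
have [l0 _] := argmaxP p mu; have [_ lmax] := argmaxP q mu.
have h := lmax _ l0.
have -> : dot (argmax p mu) (q - p) = dot (argmax p mu) q - dot (argmax p mu) p.
  by rewrite dotDr -scaleN1r dotZr mulN1r.
by move: h; rewrite /legendre /payoff; lra.
Qed.

(** Envelope theorem: by the subgradient inequality at [p] and at [p + h v] the
    difference quotient lies between [dot (argmax p) v] and
    [dot (argmax (p + h v)) v]. *)
Lemma derive_legendre (v p : 'rV[R]_d) mu :
  'D_v (fun q => legendre q mu) p = dot (argmax p mu) v.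
Proof.
apply/cvg_lim => //.
set A := dot (argmax p mu) v.
pose S (h : R) := dot (argmax (h *: v + p) mu) v.
have Sc : continuous S.
  apply: dot_continuous; last exact: cst_continuous.
  apply: (continuous_fcomp (Y := ('rV[R]_d * X)%type) (f := fun h : R => (h *: v + p, mu)) _ argmax_continuous).
  apply: continuous_fpair; last exact: cst_continuous.
  move=> h; apply: cvgD; last exact: cvg_cst.
  by apply: cvgZl; exact: cvg_id.
have S0 : S 0 = A by rewrite /S scale0r add0r.
apply/cvgrPdist_le => eps eps0.
have : \forall h \near (0 : R)^', `|A - S h| <= eps.
  have /cvgrPdist_le/(_ _ eps0) := Sc 0; rewrite S0 => h; exact: (nbhs_dnbhs h).
have n0 : \forall h \near (0 : R)^', h != 0 by exact: nbhs_dnbhs_neq.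
apply: filterS2 n0 => h h0 near.
apply: le_trans near; rewrite /GRing.scale /=.
set D := legendre _ _ - _.
have lo : h * A <= D.
  have := legendre_tangent p (h *: v + p) mu; rewrite addrK dotZr; exact.
have hi : D <= h * S h.
  have := legendre_tangent (h *: v + p) p mu.
  by rewrite opprD addrCA subrr addr0 -scaleNr dotZr mulNr /D -/(S h); lra.
have [hp|hn] := ltP 0 h.
  have l1 : A <= h^-1 * D by rewrite ler_pdivlMl.
  have l2 : h^-1 * D <= S h by rewrite ler_pdivrMl.
  by rewrite !ler0_norm ?subr_le0 //; [lra|exact: le_trans l2].
have {}hn : h < 0 by rewrite lt_neqAle h0.
have l1 : h^-1 * D <= A by rewrite ler_ndivrMl.
have l2 : S h <= h^-1 * D by rewrite ler_ndivlMl.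
by rewrite !ger0_norm ?subr_ge0 //; [lra|exact: le_trans l1].
Qed.

End Legendre.

(** * Reduction of the mean field game to a forward-backward system *)

(** Precomposition with a continuous map into [A], such as a retraction, turns
    continuity relative to [A] into continuity everywhere. *)
Lemma continuous_within_into (X Y Z : topologicalType) (A : set Y) (q : X -> Y) (f : Y -> Z) :
  {within A, continuous f} -> continuous q -> (forall x, A (q x)) ->
  continuous (fun x => f (q x)).
Proof.
move=> /subspace_continuousP fA qc Aq x W hW.
have hq : nbhs x [set y | A (q y) -> W (f (q y))] by exact: qc x _ (fA _ (Aq x) _ hW).
suff : nbhs x [set y | W (f (q y))] by [].
by apply: filterS hq => y; apply; exact: Aq.
Qed.

Section Instance.
Variables (R : realType) (N : nat) (e : rel 'I_N).
Variable L : forall i : 'I_N, 'rV[R]_(deg e i) -> 'rV[R]_N -> R.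

Lemma norm_le_enorm n (x : 'rV[R]_n) : `|x| <= enorm x.
Proof.
apply: rV_norm_le => [|i]; first exact: sqrtr_ge0.
rewrite -sqrtr_sqr /enorm ler_wsqrtr // /dot (bigD1 i) //= -expr2 lerDl.
by apply: sumr_ge0 => j _; rewrite -expr2 sqr_ge0.
Qed.

Definition positive_part n (x : 'rV[R]_n) : 'rV[R]_n := \row_k Num.max (x 0 k) 0.

Lemma positive_part_orthant n (x : 'rV[R]_n) : orthant (positive_part x).
Proof. by move=> k; rewrite mxE le_max lexx orbT. Qed.

Lemma positive_part_id n (x : 'rV[R]_n) : orthant x -> positive_part x = x.
Proof. by move=> x0; apply/rowP => k; rewrite mxE max_l. Qed.

Lemma positive_part_continuous n : continuous (@positive_part n).
Proof.
apply: rV_continuous => i; rewrite (_ : (fun _ => _) = (fun x : 'rV[R]_n => Num.max (x 0 i) 0)).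
  apply: continuous_fmax; [exact: coord_continuous|exact: cst_continuous].
by apply/funext => x; rewrite mxE.
Qed.

(** The simplex is contained in the unit cube, so the growth condition for
    [K = 1] suffices; the sup norm is dominated by the Euclidean one. *)
Lemma superlinear_coercive (i : 'I_N) (B : R) :
  (forall (l : 'rV[R]_(deg e i)) mu, orthant l -> orthant mu -> 0 <= L l mu) ->
  superlinear L i 1 ->
  exists r, forall l : 'rV[R]_(deg e i), orthant l -> r < `|l| ->
    forall mu, simplex mu -> B * `|l| <= L l mu.
Proof.
move=> L0 /(_ (Num.max B 0))[r hr]; exists (Num.max r 0) => l l0.
rewrite gt_max => /andP[rl l_gt0] mu muS.
have ll := norm_le_enorm l; have e_gt0 : 0 < enorm l := lt_le_trans l_gt0 ll.
have := hr l l0 (lt_le_trans rl ll).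
set S := [set _ | _ in _] => lt.
have : inf S <= L l mu / enorm l.
  apply: ge_inf; first by exists 0 => _ [nu nuC <-]; rewrite divr_ge0 ?sqrtr_ge0 //;
    apply: L0 => // k; have /andP[] := nuC k.
  by exists mu => // k; rewrite muS.1 simplex_le1.
move=> /(lt_le_trans lt)/ltW; rewrite ler_pdivlMr //; apply: le_trans.
apply: (@le_trans _ _ (Num.max B 0 * `|l|)); first by rewrite ler_wpM2r // le_max lexx.
by rewrite ler_wpM2l // le_max lexx orbT.
Qed.

Lemma increments_continuous i : continuous (@increments R N e i).
Proof.
apply: rV_continuous => k; rewrite (_ : (fun _ => _) = (fun v : 'rV[R]_N => v 0 (succ_of k) - v 0 i)).
  by apply: continuous_fB; exact: coord_continuous.
by apply/funext => x; rewrite mxE.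
Qed.

Lemma basis_vec_nonsucc i j : j \notin succs e i -> basis_vec R e i j = 0.
Proof.
move=> ij; apply/rowP => k; rewrite !mxE; case: eqP => // kj.
by have := enum_valP k; rewrite -/(succ_of k) kj (negbTE ij).
Qed.
End Instance.

Theorem theorem1 (R : realType) (T : R) (T_gt0 : 0 < T)
  (N : nat) (e : rel 'I_N) (e_irr : irreflexive e)
  (L : forall i : 'I_N, 'rV[R]_(deg e i) -> 'rV[R]_N -> R)
  (f g : 'I_N -> 'rV[R]_N -> R)
  (L_ge0 : forall (i : 'I_N) (l : 'rV[R]_(deg e i)) (mu : 'rV[R]_N),
     orthant l -> orthant mu -> 0 <= L i l mu)
  (L_cont : forall i : 'I_N,
     {within @orthant R (deg e i) `*` @orthant R N,
       continuous (fun z : 'rV[R]_(deg e i) * 'rV[R]_N => L i z.1 z.2)})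
  (f_cont : forall i : 'I_N, {within @orthant R N, continuous (f i)})
  (g_cont : forall i : 'I_N, {within @orthant R N, continuous (g i)})
  (L_convex : forall (i : 'I_N) (mu : 'rV[R]_N), orthant mu ->
     strictly_convex_on (@orthant R (deg e i)) (fun l => L i l mu))
  (L_superlinear : forall (i : 'I_N) (K : R), 0 < K -> superlinear L i K)
  (m0 : 'rV[R]_N) (m0_simplex : simplex m0) :
  exists u m : R -> 'rV[R]_N, C1_mfg_solution L f g T m0 u m.
Proof.
pose rho := retract m0.
have rhoS x : simplex (rho x) by exact: retract_simplex.
have rhoO x : orthant (rho x) by have [] := rhoS x.
have rhoI x : simplex x -> rho x = x by exact: retract_id.
have rhoc : continuous rho by exact: retract_continuous.
(* All the data are extended continuously to the whole space, through the
   positive part of [l] and the retraction [rho] of [mu]. *)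
pose Lh i (l : 'rV[R]_(deg e i)) (mu : 'rV[R]_N) := L i (positive_part l) (rho mu).
have LhE i l mu : orthant l -> simplex mu -> Lh i l mu = L i l mu.
  by move=> l0 muS; rewrite /Lh positive_part_id // rhoI.
have Lhc i : continuous (fun z : 'rV[R]_(deg e i) * 'rV[R]_N => Lh i z.1 z.2).
  pose q (z : 'rV[R]_(deg e i) * 'rV[R]_N) := (positive_part z.1, rho z.2).
  apply: (continuous_within_into (q := q) (L_cont i)).
    apply: continuous_fpair.
      by apply: (continuous_fcomp _ (@positive_part_continuous _ _)) => z; exact: cvg_fst.
    by apply: (continuous_fcomp _ rhoc) => z; exact: cvg_snd.
  by move=> z; split; [exact: positive_part_orthant|exact: rhoO].
have Lhconv i mu : strictly_convex_on (@orthant R (deg e i)) (Lh i ^~ mu).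
  move=> x y s x0 y0 ne /andP[s0 s1]; rewrite /Lh !positive_part_id //.
    by apply: L_convex => //; rewrite s0.
  by move=> k; rewrite !mxE addr_ge0 // mulr_ge0 ?x0 ?y0 ?subr_ge0 // ltW.
have Lhco i B : exists r, forall l : 'rV[R]_(deg e i), orthant l -> r < `|l| ->
    forall mu, B * `|l| <= Lh i l mu.
  have [r hr] := superlinear_coercive B (L_ge0 i) (L_superlinear i 1 ltr01).
  by exists r => l l0 rl mu; rewrite /Lh positive_part_id //; exact: hr.
have [C0 C00 hC0] : exists2 C0, 0 <= C0 & forall i mu, Lh i 0 mu <= C0.
  have cc i : continuous (Lh i 0).
    apply: (continuous_fcomp (f := fun mu => (0 : 'rV[R]_(deg e i), mu)) _ (Lhc i)).
    by apply: continuous_fpair => [|x]; [exact: cst_continuous|exact: cvg_id].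
  have [C0 C00 h] := compact_bound_fin (@compact_simplex R N) cc.
  exists C0 => // i mu; have := h i _ (rhoS mu).
  by rewrite /Lh [rho (rho mu)]rhoI //; apply: le_trans; exact: ler_norm.
have fc i : continuous (fun mu => f i (rho mu)) by exact: continuous_within_into (f_cont i) rhoc rhoO.
have gc i : continuous (fun mu => g i (rho mu)) by exact: continuous_within_into (g_cont i) rhoc rhoO.
have [G G0 hG] := compact_bound_fin (@compact_simplex R N) gc.
have [Ff Ff0 hFf] := compact_bound_fin (@compact_simplex R N) fc.
pose lam i := argmax (Lh i).
pose H i := legendre (Lh i).
pose inc i (z : 'rV[R]_N * 'rV[R]_N) := increments e i z.1.
have incc i : continuous (inc i).
  by apply: (continuous_fcomp _ (@increments_continuous R N e i)) => z; exact: cvg_fst.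
have sndc : continuous (fun z : 'rV[R]_N * 'rV[R]_N => z.2) by move=> z; exact: cvg_snd.
have pairc i : continuous (fun z : 'rV[R]_N * 'rV[R]_N => (inc i z, z.2)).
  exact: continuous_fpair (incc i) sndc.
have lamP i p mu : is_argmax (Lh i) p mu (lam i p mu).
  exact: (argmaxP (Lhc i) (Lhco i) (hC0 i)).
pose b i (z : 'rV[R]_N * 'rV[R]_N) := H i (inc i z) z.2 + f i (rho z.2).
pose a i j (z : 'rV[R]_N * 'rV[R]_N) := dot (lam i (inc i z) z.2) (basis_vec R e i j).
have bc i : continuous (b i).
  apply: continuous_fD.
    exact: continuous_fcomp (pairc i) (legendre_continuous (Lhc i) (Lhconv i) (Lhco i) (hC0 i)).
  exact: continuous_fcomp sndc (fc i).
have ac i j : continuous (a i j).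
  apply: dot_continuous; last exact: cst_continuous.
  exact: continuous_fcomp (pairc i) (argmax_continuous (Lhc i) (Lhconv i) (Lhco i) (hC0 i)).
pose F := C0 + Ff.
have F0 : 0 <= F by rewrite addr_ge0.
pose C := G + T * F.
have a0 i j (z : 'rV[R]_N * 'rV[R]_N) : simplex z.2 -> 0 <= a i j z.
  move=> _; apply: sumr_ge0 => k _; rewrite mulr_ge0 //; last by rewrite mxE.
  by have [] := lamP i (inc i z) z.2.
(* For values of norm at most [C], increments have norm at most [2 * C]. *)
have /choice[Lam hLam] : forall i, exists Lam, 0 <= Lam /\
    forall p mu, `|p| <= 2 * C -> `|lam i p mu| <= Lam.
  move=> i; have [Lam Lam0 h] := argmax_bounded (Lhc i) (Lhco i) (hC0 i) (2 * C).
  by exists Lam.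
pose rate := \sum_i (deg e i)%:R * Lam i.
have rate0 : 0 <= rate by apply: sumr_ge0 => i _; rewrite mulr_ge0 // (hLam i).1.
have h0_gt0 : 0 < (rate + 1)^-1 by rewrite invr_gt0 ltr_wpDl.
(* The threshold on [h] makes the total jump probability in one step at
   most 1, which is what the upper bound needs; the lower bound comes from the
   competitor [0]. *)
have stable h : 0 < h -> h <= (rate + 1)^-1 -> forall i (u m : 'rV[R]_N) c,
    simplex m -> `|u| <= c -> c <= C -> `|u 0 i + h * b i (u, m)| <= c + h * F.
  move=> h_gt0 hh i u m c mS uc cC; set p := increments e i u.
  have ui k : - c <= u 0 k <= c by rewrite -ler_norml; apply: le_trans uc; exact: rV_coord_le.
  have c_ge0 : 0 <= c by exact: le_trans uc.
  have pC : `|p| <= 2 * C.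
    apply: (@le_trans _ _ (2 * c)); last by rewrite ler_pM2l.
    apply: rV_norm_le => [|k]; first by rewrite mulr_ge0.
    rewrite mxE ler_norml; have := ui (succ_of k); have := ui i; lra.
  have [l0 _] := lamP i p m; set l := lam i p m in l0.
  have lL k : l 0 k <= Lam i.
    apply: le_trans (ler_norm _) _; apply: le_trans (rV_coord_le _ _) _; exact: (hLam i).2.
  have sum_l : h * \sum_k l 0 k <= 1.
    apply: (@le_trans _ _ ((rate + 1)^-1 * (rate + 1))); last by rewrite mulVf // gt_eqF // ltr_wpDl.
    apply: ler_pM => //; [exact: ltW|by apply: sumr_ge0|].
    apply: (@le_trans _ _ rate); last by rewrite lerDl.
    apply: (@le_trans _ _ ((deg e i)%:R * Lam i)).
      rewrite mulr_natl -[X in _ *+ X]card_ord -sumr_const; exact: ler_sum.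
    rewrite /rate (bigD1 i) //= lerDl; apply: sumr_ge0 => j _.
    by rewrite mulr_ge0 // (hLam j).1.
  have Hge : - C0 <= H i p m by exact: (legendre_ge (Lhc i) (Lhco i) (hC0 i)).
  have := hFf i m mS; rewrite rhoI // ler_norml => /andP[f1 f2].
  have bE : b i (u, m) = H i p m + f i m by rewrite /b /= rhoI.
  have up : h * H i p m <= c - u 0 i.
    apply: (legendre_step_le (Lhc i) (Lhco i) (hC0 i)) => //.
    - by move=> l' nu l'0; apply: L_ge0; [exact: positive_part_orthant|exact: rhoO].
    - exact: ltW.
    - by rewrite subr_ge0; case/andP: (ui i).
    - by move=> k; rewrite mxE lerD2r; case/andP: (ui (succ_of k)).
  have dn : - (h * C0) <= h * H i p m by rewrite -mulrN ler_pM2l.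
  have f3 : h * f i m <= h * Ff by rewrite ler_pM2l.
  have f4 : - (h * Ff) <= h * f i m by rewrite -mulrN ler_pM2l.
  have := mulr_ge0 (ltW h_gt0) C00.
  rewrite bE [h * (H i p m + _)]mulrDr [h * F]mulrDr ler_norml; have := ui i; lra.
have gG i m : simplex m -> `|g i (rho m)| <= G by exact: hG.
have [u [m [mS uT m_0 uC1 mC1]]] := forward_backward_system T_gt0 m0_simplex bc ac gc
  F0 G0 h0_gt0 gG a0 stable.
have HamE i q mu : simplex mu -> Ham L q mu = H i q mu.
  move=> muS; rewrite /H -(legendre_sup (Lhc i) (Lhco i) (hC0 i)) /Ham.
  by congr sup; apply: eq_imagel => l l0; rewrite LhE.
have dHamE i j q mu : simplex mu -> dHam L j q mu = dot (lam i q mu) (basis_vec R e i j).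
  move=> muS; rewrite /dHam (_ : (fun q' => _) = (fun q' => H i q' mu)).
    exact: (derive_legendre (Lhc i) (Lhconv i) (Lhco i) (hC0 i)).
  by apply/funext => q'; rewrite HamE.
have a_nonsucc i j z : j \notin succs e i -> a i j z = 0.
  by move=> ij; rewrite /a basis_vec_nonsucc // /dot big1 // => k _; rewrite mxE mulr0.
have TT : T \in `[0, T] by rewrite in_itv /= lexx ltW.
exists u, m; split => //.
- by move=> i; have [] := uC1 i.
- by move=> i; have [] := mC1 i.
- move=> i; split => [t tT|]; last by rewrite uT rhoI //; exact: mS.
  have mtS := mS t tT; have [_ ->//] := uC1 i.
  by rewrite (HamE i) // /b /= rhoI // -addrA addNr.
split => // i t tT; have mtS := mS t tT.
have [_ ->//] := mC1 i; rewrite /drift; congr (_ - _).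
  rewrite [RHS]big_mkcond /=; apply: eq_bigr => j _; case: ifP => [_|/negbT jp].
    by rewrite (dHamE j).
  by rewrite a_nonsucc ?mul0r // inE; move: jp; rewrite inE.
rewrite mulr_suml [RHS]big_mkcond /=; apply: eq_bigr => j _; case: ifP => [_|/negbT jp].
  by rewrite (dHamE i).
by rewrite a_nonsucc ?mul0r.
Qed.
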